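(* Let $2 \le a < b \le d-2$ be integers. Let $R = k[x^{\alpha}y^{d-\alpha} \mid \alpha \in \{0,d\} \cup [a,b]]$ and $Q = (x^d,y^d)$. Then $R$ is a Cohen-Macaulay ring and (1) $\operatorname{reg}(R) = r_Q(R_+) = \left\lceil\dfrac{a+d-1}{b}\right\rceil$ if $b \ge 2a-1$; (2) $\operatorname{reg}(R) = r_Q(R_+) = \left\lceil\dfrac{2a+d-1}{b}\right\rceil$ if $\dfrac{3a-1}{2} \le b < 2a-1$.
   Context: $k$ is a field and $x,y$ are variables; $[p,q]$ denotes the set of integers $\alpha$ with $p \le \alpha \le q$. $R$ is the $k$-subalgebra of $k[x,y]$ generated by the indicated monomials of degree $d$, graded so that each of these generating monomials has degree $1$: $R = \bigoplus_{n\ge 0} R_n$, and $R_+ = \bigoplus_{n\ge 1} R_n$. $Q$ is the ideal of $R$ generated by $x^d$ and $y^d$. It is a reduction of $R_+$, and $r_Q(R_+)$ is the least integer $r \ge 0$ with $Q(R_+)^r = (R_+)^{r+1}$. $\operatorname{reg}(R)$ is the Castelnuovo-Mumford regularity: write $R$ as a graded quotient of a standard graded polynomial ring $S$ over $k$ (variables mapping to the generating monomials), let $0 \to F_p \to \cdots \to F_0 \to R \to 0$ be a minimal graded free resolution over $S$, let $b_i$ be the maximal degree of the generators of $F_i$; then $\operatorname{reg}(R) = \max\{b_i - i \mid i = 0,\ldots,p\}$. *)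

(* Defs.v *)
From HB Require Import structures.
From mathcomp Require Import all_boot all_order all_algebra.
From mathcomp Require Import boolp.
From mathcomp Require Import mpoly.

Set Implicit Arguments.
Unset Strict Implicit.
Unset Printing Implicit Defensive.

Import Order.TTheory GRing.Theory Num.Theory.
Local Open Scope ring_scope.

(* Ideals are arbitrary [Prop]-valued predicates, so that no decidability of
   membership is built into the quantifications over ideals below. *)
Section Ideals.
Variable A : comNzRingType.
Implicit Types (I J P : A -> Prop) (X : A -> Prop) (s : seq A).

Definition is_ideal I : Prop :=
  [/\ I 0, forall u v, I u -> I v -> I (u + v) & forall c u, I u -> I (c * u)].

Definition sub_ideal I J : Prop := forall u, I u -> J u.
Definition eq_ideal I J : Prop := forall u, I u <-> J u.

Definition ideal_gen X : A -> Prop :=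
  fun u => forall I, is_ideal I -> (forall x, X x -> I x) -> I u.

Definition ideal_mul I J : A -> Prop :=
  ideal_gen (fun w => exists u v, [/\ I u, J v & w = u * v]).

Definition ideal_exp I n : A -> Prop := iter n (ideal_mul I) (fun=> True).

Definition prime_ideal P : Prop :=
  [/\ is_ideal P, ~ P 1 & forall u v, P (u * v) -> P u \/ P v].

Definition maximal_ideal P : Prop :=
  [/\ is_ideal P, ~ P 1 &
      forall J, is_ideal J -> sub_ideal P J -> J 1 \/ sub_ideal J P].

Definition noetherian : Prop :=
  forall I, is_ideal I -> exists s, eq_ideal I (ideal_gen (fun x => x \in s)).

(* A strictly increasing chain [p 0 < ... < p n = P] of prime ideals. *)
Definition prime_chain P n : Prop :=
  exists p : nat -> A -> Prop,
    [/\ forall i, (i <= n)%N -> prime_ideal (p i),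
        forall i, (i < n)%N ->
          sub_ideal (p i) (p i.+1) /\ ~ sub_ideal (p i.+1) (p i)
      & eq_ideal (p n) P].

Definition height P n : Prop :=
  prime_chain P n /\ forall m, prime_chain P m -> (m <= n)%N.

Definition regular_seq s : Prop :=
  (forall i u, (i < size s)%N ->
     ideal_gen (fun x => x \in take i s) (s`_i * u) ->
     ideal_gen (fun x => x \in take i s) u)
  /\ ~ ideal_gen (fun x => x \in s) 1.

Definition regular_seq_in I n : Prop :=
  exists s, [/\ size s = n, forall x, x \in s -> I x & regular_seq s].

Definition depth I n : Prop :=
  regular_seq_in I n /\ forall m, regular_seq_in I m -> (m <= n)%N.

(* As in Eisenbud, "Commutative Algebra", Section 18.2: a Noetherian ring with
   depth(m, A) = codim(m) for every maximal ideal m. *)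
Definition cohen_macaulay : Prop :=
  noetherian /\
  forall m, maximal_ideal m -> exists n, height m n /\ depth m n.

(* [r] is the least natural number with [Q I^r = I^(r+1)]. *)
Definition reduction_number (Q I : A -> Prop) (r : nat) : Prop :=
  let reduces n := eq_ideal (ideal_mul Q (ideal_exp I n)) (ideal_exp I n.+1) in
  reduces r /\ forall n, reduces n -> (r <= n)%N.

(* The ideal of finite sums of elements of positive degree. *)
Definition irrelevant_ideal (gr : nat -> A -> Prop) : A -> Prop :=
  fun u => exists n (c : nat -> A),
    (forall i, gr i.+1 (c i)) /\ u = \sum_(i < n) c i.

End Ideals.

Section Regularity.
Variables (k : fieldType) (A : comAlgType k) (gr : nat -> A -> Prop).
Variables (N : nat) (t : 'I_N -> A).

Local Notation S := {mpoly k[N]}.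

(* The k-algebra morphism from S to A sending the i-th variable to [t i]. *)
Definition gen_eval (p : S) : A := mmap (in_alg A) t p.

(* A minimal graded free resolution 0 -> F_p -> ... -> F_0 -> A -> 0 of the
   graded S-module A, with p = [fr_len].  The module F_i is the direct sum of
   the S(- fr_deg i j) for j < [fr_rank i], its elements being row vectors;
   F_(i+1) -> F_i is right multiplication by [fr_diff i], and F_0 -> A sends
   the j-th basis vector to [fr_aug j].  The shifts can be taken in nat as
   A lives in nonnegative degrees. *)
Record min_graded_free_res := MinGradedFreeRes {
  fr_len : nat;
  fr_rank : nat -> nat;
  fr_deg : forall i, 'I_(fr_rank i) -> nat;
  fr_diff : forall i, 'M[S]_(fr_rank i.+1, fr_rank i);
  fr_aug : 'I_(fr_rank 0) -> A;
  fr_rankP : forall i, (0 < fr_rank i)%N = (i <= fr_len)%N;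
  fr_aug_deg : forall j, gr (fr_deg j) (fr_aug j);
  fr_diff_deg : forall i (l : 'I_(fr_rank i.+1)) (j : 'I_(fr_rank i)),
    ((fr_deg j <= fr_deg l)%N ->
       fr_diff i l j \is (fr_deg l - fr_deg j).-homog) /\
    ((fr_deg l < fr_deg j)%N -> fr_diff i l j = 0);
  fr_aug_surj : forall x : A, exists u : 'rV[S]_(fr_rank 0),
    x = \sum_j gen_eval (u 0 j) * fr_aug j;
  fr_exact0 : forall u : 'rV[S]_(fr_rank 0),
    \sum_j gen_eval (u 0 j) * fr_aug j = 0 <->
    exists v : 'rV[S]_(fr_rank 1), u = v *m fr_diff 0;
  fr_exact : forall i (u : 'rV[S]_(fr_rank i.+1)),
    u *m fr_diff i = 0 <->
    exists v : 'rV[S]_(fr_rank i.+2), u = v *m fr_diff i.+1;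
  (* minimality: the image of F_(i+1) lies in S_+ F_i *)
  fr_min : forall i l j, (fr_diff i l j)@_0%MM = 0
}.

(* The number b_i. *)
Definition fr_maxdeg (F : min_graded_free_res) (i : nat) : nat :=
  \max_(j < fr_rank F i) fr_deg j.

Definition fr_reg (F : min_graded_free_res) : int :=
  \big[Order.max/(fr_maxdeg F 0)%:Z]_(i < (fr_len F).+1)
    ((fr_maxdeg F i)%:Z - i%:Z).

(* A minimal graded free resolution is unique up to isomorphism, so at most
   one [r] qualifies. *)
Definition regularity (r : int) : Prop :=
  exists F : min_graded_free_res, r = fr_reg F.

End Regularity.

Section Subalgebra.
Variables (k : fieldType) (A : comAlgType k) (X : seq A).

Definition is_subalgebra (B : A -> Prop) : Prop :=
  [/\ B 1, forall (c : k) u v, B u -> B v -> B (c *: u + v)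
    & forall u v, B u -> B v -> B (u * v)].

Definition subalg_mem : {pred A} := fun p =>
  `[< forall B, is_subalgebra B -> (forall x, x \in X -> B x) -> B p >].

Lemma subalg_mem_closed : subalg_closed subalg_mem.
Proof.
split=> [|c u v /asboolP hu /asboolP hv|u v /asboolP hu /asboolP hv];
  apply/asboolP => B hB hX; case: (hB) => h1 hl hm.
- exact: h1.
- by apply: hl; [apply: hu | apply: hv].
- by apply: hm; [apply: hu | apply: hv].
Qed.

HB.instance Definition _ := GRing.isSubalgClosed.Build k A subalg_mem
  subalg_mem_closed.

Lemma mem_subalg x : x \in X -> x \in subalg_mem.
Proof. by move=> hx; apply/asboolP => B _; apply. Qed.

Record subalg := Subalg {
  subalg_val : A;
  subalg_valP : subalg_val \in subalg_mem
}.

HB.instance Definition _ := [isSub for subalg_val].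
HB.instance Definition _ := [Choice of subalg by <:].
HB.instance Definition _ := [SubChoice_isSubComNzRing of subalg by <:].
HB.instance Definition _ := [SubZmodule_isSubLmodule of subalg by <:].
HB.instance Definition _ := [SubNzRing_SubLmodule_isSubLalgebra of subalg by <:].
HB.instance Definition _ := [SubLalgebra_isSubAlgebra of subalg by <:].

Definition subalg_gen (i : 'I_(size X)) : subalg :=
  Subalg (mem_subalg (mem_nth 0 (ltn_ord i))).

End Subalgebra.

Section MonomialAlgebra.
Variables (k : fieldType) (a b d : nat).

Definition xvar : {mpoly k[2]} := 'X_ord0.
Definition yvar : {mpoly k[2]} := 'X_ord_max.

(* [index_iota a b.+1] enumerates the integers from a to b. *)
Definition monomials : seq {mpoly k[2]} :=
  [seq xvar ^+ i * yvar ^+ (d - i) | i <- 0%N :: d :: index_iota a b.+1].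

Definition monR := subalg monomials.

(* The generators have degree d in k[x, y] and degree 1 in R. *)
Definition monR_gr (n : nat) (p : monR) : Prop :=
  subalg_val p \is (d * n).-homog.

Definition monR_plus : monR -> Prop := irrelevant_ideal monR_gr.

Definition monQ : monR -> Prop :=
  ideal_gen (fun p : monR =>
    subalg_val p = xvar ^+ d \/ subalg_val p = yvar ^+ d).

Definition monR_reg : int -> Prop :=
  regularity monR_gr (@subalg_gen k _ monomials).

Definition monR_redn : nat -> Prop := reduction_number monQ monR_plus.

End MonomialAlgebra.

(* Main.v *)
(* Let T = k[x^d, y^d].  For a residue class c mod d let ap(c) be its least element
   that is a sum of integers of [a, b], and ht(c) = ceil(ap(c) / b) the least number
   of summands.  As b <= d, R is a free T-module on the d monomials
   b_c = x^ap(c) y^(d ht(c) - ap(c)), of degree ht(c); put r = max_c ht(c).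

   Cohen-Macaulayness: three elements of R are algebraically dependent, so neither a
   chain of primes nor a regular sequence is longer than 2; a maximal ideal contains
   some f(y^d) <> 0 and g(x^d) <> 0 (Zariski's lemma), which form a regular sequence
   by freeness, and a prime maximal among those avoiding suitable elements completes
   a chain of length 2.

   Reduction number: the monomials outside Q are exactly the b_c, so that
   Q R_+^n = R_+^(n+1) if and only if n >= r.

   Regularity: if Z_i is the matrix over T of the multiplication by the i-th of the m
   generators with exponent in [a, b], the Koszul complex of the commuting operators
   X_i - Z_i on S^d resolves R over S.  Its i-th module has generators of degree at
   most r + i, with equality for some generator when i = m.  Cancelling units in the
   differentials makes it minimal, and these last generators survive since no generator
   in homological degree m - 1 has the same degree.  Hence reg(R) = r.

   Finally r is computed from the largest ap(c), which is a + d - 1 in case (1) and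
   2a + d - 1 in case (2), except if d = 2a - 1, where it is 2a + d - 2 with the same
   value (3) of the ceiling. *)

Require Import Defs.
From mathcomp Require Import all_boot all_order all_algebra.
From mathcomp Require Import boolp mpoly zify ring.
From mathcomp Require classical_sets.

Set Implicit Arguments.
Unset Strict Implicit.
Unset Printing Implicit Defensive.

Import Order.TTheory GRing.Theory Num.Theory.
Local Open Scope ring_scope.

(** * Noetherian rings *)

Section IdealTheory.
Variable A : comNzRingType.
Implicit Types (I J : A -> Prop) (s : seq A).

(** So [ap c] has both the least exponent and the least degree, and every monomial of $R$ is
    uniquely $x^{di} y^{dj} b_c$. The maximal ideals in [cohen_macaulay] are arbitrary, and $k$ may
    be finite or not algebraically closed, so they cannot be listed; this is why the regular
    sequence at each of them is made of polynomials in $y^d$ and in $x^d$ that are only known to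
    exist. As [regularity] asks for some minimal resolution, exhibiting one is enough. It is kept as
    a single square matrix over all homological degrees, with a set of live basis elements, so that
    mapping cones and cancellations of units become uniform inductions; it is cut into layers only
    at the end. *)

Lemma ideal_sum I (T : Type) (r : seq T) (P : pred T) (F : T -> A) :
  is_ideal I -> (forall i, P i -> I (F i)) -> I (\sum_(i <- r | P i) F i).
Proof. by case=> h0 hD _ hF; apply: big_ind. Qed.
Arguments ideal_sum [I T] r [P F].

Lemma ideal0 I : is_ideal I -> I 0. Proof. by case. Qed.

Lemma idealD I u v : is_ideal I -> I u -> I v -> I (u + v).
Proof. by case=> _ hD _; apply: hD. Qed.

Lemma idealM I c u : is_ideal I -> I u -> I (c * u).
Proof. by case=> _ _ hM; apply: hM. Qed.

Lemma idealN I u : is_ideal I -> I u -> I (- u).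
Proof. by move=> hI hu; rewrite -mulN1r; apply: idealM. Qed.

Lemma idealB I u v : is_ideal I -> I u -> I v -> I (u - v).
Proof. by move=> hI hu hv; apply: idealD => //; apply: idealN. Qed.

Lemma ideal_gen_ideal (X : A -> Prop) : is_ideal (ideal_gen X).
Proof.
split=> [I [] //|u v hu hv I hI hX|c u hu I hI hX]; case: (hI) => _ hD hM.
  by apply: hD; [apply: hu|apply: hv].
by apply: hM; apply: hu.
Qed.

Lemma mem_ideal_gen (X : A -> Prop) x : X x -> ideal_gen X x.
Proof. by move=> hx I _; apply. Qed.

Lemma ideal_genS (X Y : A -> Prop) : (forall x, X x -> ideal_gen Y x) ->
  sub_ideal (ideal_gen X) (ideal_gen Y).
Proof. by move=> h u /(_ _ (ideal_gen_ideal Y)); apply. Qed.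

Lemma ideal_gen_seqP s u : ideal_gen (fun x => x \in s) u <->
  exists c : nat -> A, u = \sum_(i < size s) c i * s`_i.
Proof.
split=> [|[c ->]]; last first.
  apply: (ideal_sum _ (ideal_gen_ideal _)) => i _.
  apply: (idealM _ (ideal_gen_ideal _)).
  by apply: mem_ideal_gen; apply: mem_nth.
have hI : is_ideal (fun v => exists c : nat -> A, v = \sum_(i < size s) c i * s`_i).
  split.
  - by exists (fun=> 0); rewrite big1 // => i _; rewrite mul0r.
  - move=> v w [c ->] [c' ->]; exists (fun i => c i + c' i).
    by rewrite -big_split; apply: eq_bigr => i _; rewrite mulrDl.
  - move=> a v [c ->]; exists (fun i => a * c i).
    by rewrite mulr_sumr; apply: eq_bigr => i _; rewrite mulrA.
move/(_ _ hI); apply=> x xs; exists (fun i => (i == index x s)%:R).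
have h : (index x s < size s)%N by rewrite index_mem.
rewrite (bigD1 (Ordinal h)) //= eqxx mul1r nth_index // big1 ?addr0 // => i.
by rewrite -val_eqE /= => /negPf ->; rewrite mul0r.
Qed.

Lemma ideal_gen1P (x u : A) : ideal_gen (fun y => y \in [:: x]) u <-> exists c, u = c * x.
Proof.
rewrite ideal_gen_seqP; split=> [[c ->]|[c ->]].
  by exists (c 0%N); rewrite big_ord1.
by exists (fun=> c); rewrite big_ord1.
Qed.

Lemma principal_ideal (x : A) : is_ideal (fun u => exists c, u = c * x).
Proof.
split; first by exists 0; rewrite mul0r.
  by move=> u v [c ->] [c' ->]; exists (c + c'); rewrite mulrDl.
by move=> a u [c ->]; exists (a * c); rewrite mulrA.
Qed.

Lemma extended_ideal I (x : A) : is_ideal I ->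
  is_ideal (fun w => exists p c, I p /\ w = p + c * x).
Proof.
move=> hI; split.
- by exists 0, 0; rewrite mul0r addr0; split=> //; apply: ideal0.
- move=> u v [p [c [hp ->]]] [p' [c' [hp' ->]]].
  by exists (p + p'), (c + c'); rewrite mulrDl addrACA; split=> //; apply: idealD.
- move=> a u [p [c [hp ->]]]; exists (a * p), (a * c).
  by rewrite mulrDr mulrA; split=> //; apply: idealM.
Qed.

Lemma maximal_inverse (m : A -> Prop) x :
  maximal_ideal m -> ~ m x -> exists g, m (g * x - 1).
Proof.
case=> hI h1 hmax nx.
have [|[p [c [hp h]]]|h] := hmax _ (extended_ideal x hI).
- by move=> y hy; exists y, 0; rewrite mul0r addr0.
- by exists c; rewrite h opprD addrCA subrr addr0; apply: idealN.
- by case: nx; apply: h; exists 0, 1; rewrite mul1r add0r; split=> //; apply: ideal0.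
Qed.

Lemma maximal_prime (m : A -> Prop) : maximal_ideal m -> prime_ideal m.
Proof.
move=> hm; have [hI h1 _] := hm; split=> // u v huv.
have [|/(maximal_inverse hm) [g hg]] := pselect (m u); [by left|right].
have -> : v = g * (u * v) - v * (g * u - 1) by ring.
by apply: idealB => //; apply: idealM.
Qed.

End IdealTheory.

(** * Hilbert's basis theorem *)

Section HilbertBasis.
Variable B : comNzRingType.
Hypothesis noethB : noetherian B.

(** Hilbert's argument by contradiction: each [f m] is an element of least size of [I] outside the
    ideal generated by its predecessors, and the ideals [lc m] of leading coefficients must become
    stationary. *)
Lemma hilbert_basis : noetherian {poly B}.
Proof.
move=> I hI; apply: contrapT => hfg.
have gen_sub (s : seq {poly B}) :
    {in s, forall x, I x} -> sub_ideal (ideal_gen (fun x => x \in s)) I.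
  by move=> hs u /(_ I hI); apply.
(* Stated for every [s], with the junk value 0 when [s] is not contained in [I], so that choice
   yields a total function to iterate. *)
have next (s : seq {poly B}) : exists f, {in s, forall x, I x} ->
    [/\ I f, ~ ideal_gen (fun x => x \in s) f &
     forall g, I g -> ~ ideal_gen (fun x => x \in s) g -> (size f <= size g)%N].
  have [hs|] := pselect {in s, forall x, I x}; last by move=> h; exists 0.
  pose P m := `[< exists f, [/\ I f, ~ ideal_gen (fun x => x \in s) f & size f = m] >].
  have exP : exists m, P m.
    have [f hf] : exists f, I f /\ ~ ideal_gen (fun x => x \in s) f.
      apply: contrapT => h; apply: hfg; exists s => f; split; last exact: gen_sub.
      by move=> hf; apply: contrapT => hn; apply: h; exists f.
    by exists (size f); apply/asboolP; exists f; case: hf.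
  case: (ex_minnP exP) => m /asboolP[f [hf hn sf]] hm; exists f => _; split=> // g hg hgn.
  by rewrite sf; apply: hm; apply/asboolP; exists g.
have {next}[next nextP] := choice next.
pose T m := iter m (fun s => rcons s (next s)) [::].
pose f i := next (T i).
have TS m : T m.+1 = rcons (T m) (f m) by [].
have TE m : T m = mkseq f m.
  by elim: m => // m IH; rewrite TS IH /mkseq -[in RHS]addn1 iotaD map_cat /= add0n cats1.
have TI m : {in T m, forall x, I x}.
  elim: m => // m IH x; rewrite TS mem_rcons inE => /orP[/eqP ->|/IH //].
  by have [] := nextP _ IH.
have fP m : [/\ I (f m), ~ ideal_gen (fun x => x \in T m) (f m) &
    forall g, I g -> ~ ideal_gen (fun x => x \in T m) g -> (size (f m) <= size g)%N].
  exact: nextP _ (TI m).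
have Tmono m m' : (m <= m')%N -> {subset T m <= T m'}.
  move=> h x; rewrite !TE => /mapP[i hi ->]; apply: map_f.
  by move: hi; rewrite !mem_iota; lia.
pose lc m := ideal_gen (fun x => x \in [seq lead_coef p | p <- T m]).
have lc_mono m m' : (m <= m')%N -> sub_ideal (lc m) (lc m').
  move=> h; apply: ideal_genS => x /mapP[p hp ->]; apply: mem_ideal_gen.
  by apply: map_f; apply: Tmono hp.
have hL : is_ideal (fun u => exists m, lc m u).
  split=> [|u v [m hu] [m' hv]|c u [m hu]].
  - by exists 0%N; apply: (ideal0 (ideal_gen_ideal _)).
  - exists (maxn m m').
    apply: (idealD (ideal_gen_ideal _)).
      by apply: (lc_mono m); rewrite ?leq_maxl.
    by apply: (lc_mono m'); rewrite ?leq_maxr.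
  - by exists m; apply: (idealM _ (ideal_gen_ideal _)).
have [t ht] := noethB hL.
have [M hM] : exists M, {in t, forall x, lc M x}.
  have : {in t, forall x, exists m, lc m x} by move=> x xt; apply/ht; apply: mem_ideal_gen.
  elim: t {ht} => [|x t IH] h; first by exists 0%N.
  have [m hm] := h x (mem_head _ _).
  have [|m' hm'] := IH; first by move=> y yt; apply: h; rewrite inE yt orbT.
  exists (maxn m m') => y; rewrite inE => /orP[/eqP ->|yt].
    by apply: (lc_mono m); rewrite ?leq_maxl.
  by apply: (lc_mono m'); rewrite ?leq_maxr //; apply: hm'.
have : lc M (lead_coef (f M)).
  have : ideal_gen (fun x => x \in t) (lead_coef (f M)).
    apply/ht; exists M.+1; apply: mem_ideal_gen; apply: map_f.
    by rewrite TS mem_rcons mem_head.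
  by move/(_ _ (ideal_gen_ideal _) hM).
rewrite /lc ideal_gen_seqP size_map => -[c hc].
have sT : size (T M) = M by rewrite TE size_mkseq.
have nthT i : (i < M)%N -> (T M)`_i = f i by move=> h; rewrite TE nth_mkseq.
have szf i : (i < M)%N -> (size (f i) <= size (f M))%N.
  move=> h; have [_ _ hmin] := fP i; have [fM fMn _] := fP M.
  apply: hmin fM _ => hh; apply: fMn; apply: ideal_genS hh => x xi.
  by apply: mem_ideal_gen; apply: Tmono xi; apply: ltnW.
have [fMI fMn fMmin] := fP M.
(* Shifting each [f i] to the size of [f M] gives a combination with the leading coefficient of
   [f M]; then [f M - g] is smaller but still outside the ideal, against the minimality of [f M]. *)
pose g := \sum_(i < M) (c i)%:P * 'X^(size (f M) - size (f i)) * f i.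
have hg : ideal_gen (fun x => x \in T M) g.
  apply: (ideal_sum _ (ideal_gen_ideal _)) => i _.
  apply: (idealM _ (ideal_gen_ideal _)).
  apply: mem_ideal_gen.
  by rewrite -nthT //; apply: mem_nth; rewrite sT.
have nzM : f M != 0.
  apply: contra_notN fMn => /eqP ->.
  exact: (ideal0 (ideal_gen_ideal _)).
have nzf i : (i < M)%N -> f i != 0.
  move=> h; have [_ hn _] := fP i; apply: contra_notN hn => /eqP ->.
  exact: (ideal0 (ideal_gen_ideal _)).
have coefg j : ((size (f M)).-1 <= j)%N -> (f M - g)`_j = 0.
  move=> hj; rewrite coefB coef_sum; apply/eqP; rewrite subr_eq0; apply/eqP.
  have coefi (i : 'I_M) : ((c i)%:P * 'X^(size (f M) - size (f i)) * f i)`_j =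
      c i * (f i)`_(j - (size (f M) - size (f i))).
    rewrite mulrAC -mulrA coefCM coefMXn ltnNge.
    have := szf i (ltn_ord i); have := nzf i (ltn_ord i); have := nzM.
    rewrite -!size_poly_gt0 => h1 h2 h3.
    by have -> : (size (f M) - size (f i) <= j)%N by lia.
  have [ej|/eqP ne] := eqVneq j (size (f M)).-1.
    rewrite {1}ej -lead_coefE hc sT; apply: eq_bigr => i _.
    rewrite (nth_map 0) ?sT // nthT //.
    rewrite coefi; congr (_ * _); rewrite lead_coefE; congr (_`_ _).
    have := szf i (ltn_ord i); have := nzf i (ltn_ord i); have := nzM.
    rewrite -!size_poly_gt0; lia.
  rewrite nth_default; last first.
    move: nzM; rewrite -size_poly_gt0; move: (size (f M)) hj ne; clear; lia.
  rewrite big1 // => i _; rewrite coefi nth_default ?mulr0 //.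
  have := szf i (ltn_ord i); have := nzf i (ltn_ord i); have := nzM.
  rewrite -!size_poly_gt0; move: (size (f M)) (size (f i)) hj ne; clear; lia.
have hsz : (size (f M - g)%R <= (size (f M)).-1)%N by apply/leq_sizeP.
have hfg' : ideal_gen (fun x => x \in T M) (f M - g).
  apply: contrapT => hn; have := fMmin _ _ hn.
  have h1 : I (f M - g) by apply: idealB => //; apply: gen_sub hg; apply: TI.
  move=> /(_ h1); move: nzM hsz; rewrite -size_poly_gt0; lia.
apply: fMn; rewrite -[f M](subrK g).
by apply: (idealD (ideal_gen_ideal _)).
Qed.

End HilbertBasis.

Lemma noetherian_surj (P A : comNzRingType) (phi : {rmorphism P -> A}) :
  noetherian P -> (forall a, exists p, phi p = a) -> noetherian A.
Proof.
move=> hP hs I hI.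
have [|s hgen] := hP (fun p => I (phi p)).
  case: hI => h0 hD hM; split=> [|u v|c u]; rewrite ?rmorph0 ?rmorphD ?rmorphM //.
    exact: hD.
  exact: hM.
exists (map phi s) => a; split=> [|]; last first.
  move=> /(_ I hI); apply=> x /mapP[p ps ->]; apply/hgen; exact: mem_ideal_gen.
have [p <-] := hs a => /hgen /ideal_gen_seqP [c ->].
apply/ideal_gen_seqP; exists (fun i => phi (c i)).
rewrite rmorph_sum size_map; apply: eq_bigr => i _.
by rewrite rmorphM (nth_map 0).
Qed.

Lemma noetherian_field (k : fieldType) : noetherian k.
Proof.
move=> I hI; have [[c [hc nc]]|h] := pselect (exists c, I c /\ c != 0).
  exists [:: c] => u; split=> [_|].
    by apply/ideal_gen1P; exists (u / c); rewrite divfK.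
  by apply=> // x; rewrite inE => /eqP ->.
exists [::] => u; split=> [hu|]; last by move=> /(_ I hI); apply.
have [->|nu] := eqVneq u 0; first exact: (ideal0 (ideal_gen_ideal _)).
by case: h; exists u.
Qed.

(** Adjoining one polynomial variable per generator gives a noetherian ring whose image contains the
    constants and [X]. This image is a subalgebra, so [hX] makes it all of [A]. *)
Lemma noetherian_finitely_generated (k : fieldType) (A : comAlgType k) (X : seq A) :
  (forall B, is_subalgebra B -> (forall x, x \in X -> B x) -> forall a, B a) ->
  noetherian A.
Proof.
move=> hX.
have [P [phi [hP hk hx]]] : exists (P : comNzRingType) (phi : {rmorphism P -> A}),
    [/\ noetherian P, forall c : k, exists p, phi p = c%:A
      & {in X, forall x, exists p, phi p = x}].
  elim: X {hX} => [|x X [P [phi [hP hk hx]]]].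
    exists k, (in_alg A); split=> //; first exact: noetherian_field.
    by move=> c; exists c.
  exists {poly P}, (horner_eval x \o map_poly phi : {rmorphism _ -> _}).
  have lift p : (horner_eval x \o map_poly phi) p%:P = phi p.
    by rewrite /= /horner_eval map_polyC hornerC.
  split; first exact: hilbert_basis.
    by move=> c; have [p hp] := hk c; exists p%:P; exact: etrans (lift p) hp.
  move=> y; rewrite inE => /orP[/eqP ->|/hx[p hp]]; last by exists p%:P; exact: etrans (lift p) hp.
  by exists 'X; rewrite /= /horner_eval map_polyX hornerX.
apply: (noetherian_surj (phi := phi) hP); apply: hX => //; split.
- by exists 1; rewrite rmorph1.
- move=> c u v [p <-] [q <-]; have [r hr] := hk c.
  by exists (r * p + q); rewrite rmorphD rmorphM hr mulr_algl.
- by move=> u v [p <-] [q <-]; exists (p * q); rewrite rmorphM.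
Qed.

(** * Krull dimension and depth at most 2 *)

Section Dimension.
Variable A : comNzRingType.

(* The lexicographically lowest term of an algebraic relation between [x0], [x1]
   and [x2] over a field, factored out; if all triples satisfy this then [A] has
   Krull dimension at most 2 (Coquand and Lombardi). *)
Definition lex_relation (x0 x1 x2 : A) := exists i j l a0 a1 a2,
  x0 ^+ i * (x1 ^+ j * (x2 ^+ l * (1 + a2 * x2) + a1 * x1) + a0 * x0) = 0.

Hypothesis dim2 : forall x0 x1 x2, lex_relation x0 x1 x2.

Lemma prime_expr (P : A -> Prop) x y i :
  prime_ideal P -> ~ P x -> P (x ^+ i * y) -> P y.
Proof.
move=> [_ _ hP] nx; elim: i => [|i IH]; first by rewrite expr0 mul1r.
by rewrite exprS -mulrA => /hP[/nx|/IH].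
Qed.

Lemma idealDr (P : A -> Prop) x y : is_ideal P -> P y -> P (x + y) -> P x.
Proof. by move=> hP hy hxy; rewrite -[x](addrK y); apply: idealB. Qed.

(** For x_i in [p i.+1] but not in [p i], the relation peels off: the power of x_i cancels modulo
    the prime [p i], then the multiple of x_i is dropped in [p i.+1]. After three rounds 1 is left
    in the prime [p 3]. *)
Lemma prime_chain_le2 (P : A -> Prop) n : prime_chain P n -> (n <= 2)%N.
Proof.
case=> p [hp hs _]; rewrite leqNgt; apply/negP => n3.
have pick i : (i < 3)%N -> exists x, p i.+1 x /\ ~ p i x.
  move=> i3; have [|_ h] := hs i; first exact: leq_trans i3 n3.
  apply: contrapT => hn; apply: h => x hx; apply: contrapT => hnx; apply: hn.
  by exists x.
have [//|x0 [x0p x0n]] := pick 0%N.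
have [//|x1 [x1p x1n]] := pick 1%N.
have [//|x2 [x2p x2n]] := pick 2%N.
have pI i : (i <= 3)%N -> prime_ideal (p i) by move=> h; apply: hp; apply: leq_trans h n3.
have sub i : (i < 3)%N -> sub_ideal (p i) (p i.+1).
  by move=> i3; have [|] := hs i; first exact: leq_trans i3 n3.
have [I3 P3 _] : prime_ideal (p 3%N) by apply: pI.
have [I2 _ _] : prime_ideal (p 2%N) by apply: pI.
have [I1 _ _] : prime_ideal (p 1%N) by apply: pI.
have [I0 _ _] : prime_ideal (p 0%N) by apply: pI.
have [i [j [l [a0 [a1 [a2 h]]]]]] := dim2 x0 x1 x2.
have := ideal0 I0; rewrite -h => /(prime_expr (pI 0%N isT) x0n) /(sub 0%N isT).
move/(idealDr I1 (idealM a0 I1 x0p)) => /(prime_expr (pI 1%N isT) x1n) /(sub 1%N isT).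
move/(idealDr I2 (idealM a1 I2 x1p)) => /(prime_expr (pI 2%N isT) x2n) /(sub 2%N isT).
by move/(idealDr I3 (idealM a2 I3 x2p)).
Qed.

Lemma regular_expr (s : seq A) i e u : regular_seq s -> (i < size s)%N ->
  ideal_gen (fun x => x \in take i s) (s`_i ^+ e * u) ->
  ideal_gen (fun x => x \in take i s) u.
Proof.
move=> [hs _] hi; elim: e => [|e IH]; first by rewrite expr0 mul1r.
by rewrite exprS -mulrA => /(hs _ _ hi) /IH.
Qed.

(** The same peeling, the ideals generated by the prefixes of [s] replacing the primes of the
    chain. *)
Lemma regular_seq_le2 (s : seq A) : regular_seq s -> (size s <= 2)%N.
Proof.
move=> hs; rewrite leqNgt; apply/negP => n3.
pose I i := ideal_gen (fun x => x \in take i s).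
have hI i : is_ideal (I i) by apply: ideal_gen_ideal.
have step i e u : (i < 3)%N -> I i (s`_i ^+ e * u) -> I i.+1 u.
  move=> i3 /(regular_expr hs (leq_trans i3 n3)); apply: ideal_genS => x hx.
  by apply: mem_ideal_gen; rewrite (take_nth 0) ?mem_rcons ?inE ?hx ?orbT // (leq_trans i3).
have mem i : (i < 3)%N -> I i.+1 s`_i.
  move=> i3; apply: mem_ideal_gen; rewrite (take_nth 0) ?(leq_trans i3) //.
  by rewrite mem_rcons mem_head.
have [i [j [l [a0 [a1 [a2 h]]]]]] := dim2 s`_0 s`_1 s`_2.
have := ideal0 (hI 0%N); rewrite -h => /(step 0%N _ _ isT).
move/(idealDr (hI 1) (idealM a0 (hI 1) (mem 0%N isT))) => /(step 1%N _ _ isT).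
move/(idealDr (hI 2) (idealM a1 (hI 2) (mem 1%N isT))) => /(step 2%N _ _ isT).
move/(idealDr (hI 3) (idealM a2 (hI 3) (mem 2%N isT))) => h1.
case: hs => _; apply; apply: ideal_genS h1 => x hx; apply: mem_ideal_gen.
exact: mem_take hx.
Qed.

End Dimension.

(** * Primes avoiding a multiplicative set *)

Section PrimeAvoidance.
Variable A : comNzRingType.
Hypothesis domA : forall x y : A, x * y = 0 -> x = 0 \/ y = 0.

Lemma zero_prime : prime_ideal (fun u : A => u = 0).
Proof.
split=> //; last by apply/eqP; rewrite oner_eq0.
by split=> // [u v -> ->|c u ->]; rewrite ?addr0 ?mulr0.
Qed.

(* An ideal containing [f] that is maximal among those avoiding a multiplicative
   set is prime. *)
Lemma exists_prime (W : A -> Prop) (f : A) :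
  W 1 -> (forall s t, W s -> W t -> W (s * t)) -> (forall c, ~ W (c * f)) ->
  exists P, [/\ prime_ideal P, P f & forall s, W s -> ~ P s].
Proof.
move=> W1 WM Wf.
pose good (I : A -> Prop) := [/\ is_ideal I, I f & forall s, W s -> ~ I s].
have gf : good (fun u => exists c, u = c * f).
  split; last by move=> s Ws [c hc]; apply: (Wf c); rewrite -hc.
    exact: principal_ideal.
  by exists 1; rewrite mul1r.
have [|P [hP maxP]] := @classical_sets.Zorn_bigcup A
  (fun I => (forall u, ~ I u) \/ good I).
  move=> F FP Ftot.
  have [h|] := pselect (forall X, F X -> forall u, ~ X u).
    by left=> u [X FX Xu]; apply: (h X FX u).
  move/existsNP => [X0 /not_implyP[FX0 /existsNP[u0 /contrapT Xu0]]]; right.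
  have gX X u : F X -> X u -> good X by move=> /FP[h /h|].
  split.
  - split.
    + by exists X0 => //; case: (gX _ _ FX0 Xu0) => /ideal0.
    + move=> u v [X FX Xu] [Y FY Yv].
      have [XY|YX] := Ftot _ _ FX FY.
        by exists Y => //; have [/idealD hY _ _] := gX _ _ FY Yv; apply: hY => //; apply: XY.
      by exists X => //; have [/idealD hX _ _] := gX _ _ FX Xu; apply: hX => //; apply: YX.
    + by move=> c u [X FX Xu]; exists X => //; have [/idealM hX _ _] := gX _ _ FX Xu; apply: hX.
  - by exists X0 => //; case: (gX _ _ FX0 Xu0).
  - by move=> s Ws [X FX Xs]; have [_ _ h] := gX _ _ FX Xs; apply: (h s).
have {hP}[hP Pf PW] : good P.
  case: hP => // h; case: (maxP (fun u => exists c, u = c * f)); last by right.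
  split=> [u /h //|/(_ f) hf]; apply: (h f); apply: hf; by exists 1; rewrite mul1r.
exists P; split=> //; split=> //; first exact: PW.
have grow x : ~ P x -> exists s p c, [/\ W s, P p & s = p + c * x].
  move=> nPx; pose I u := exists p c, P p /\ u = p + c * x.
  apply: contrapT => hn; apply: (maxP I); last first.
    right; split.
    - exact: extended_ideal.
    - by exists f, 0; rewrite mul0r addr0.
    - by move=> s Ws [p [c [hp hs]]]; apply: hn; exists s, p, c.
  split=> [u hu|/(_ x) h]; first by exists u, 0; rewrite mul0r addr0.
  by apply: nPx; apply: h; exists 0, 1; rewrite mul1r add0r; split=> //; apply: ideal0.
move=> u v huv; apply: contrapT => /not_orP[/grow [s [p [c [Ws hp hs]]]]].
move=> /grow [t [q [e [Wt hq ht]]]]; apply: (PW _ (WM _ _ Ws Wt)).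
have -> : s * t = (q + e * v) * p + c * u * q + c * e * (u * v) by rewrite hs ht; ring.
apply: idealD => //; last exact: idealM.
by apply: idealD => //; apply: idealM.
Qed.

(** As [g] is regular modulo [f], no s' g^i with s' outside [m] is a multiple of [f]. A prime over
    [f] avoiding all of them is nonzero, lies in [m] (case i = 0) and omits [g] (case s' = 1), so it
    fits strictly between 0 and [m]. *)
Lemma prime_chain_regular (m : A -> Prop) (f g : A) :
  prime_ideal m -> f != 0 -> m f -> m g ->
  (forall u c, g * u = c * f -> exists c', u = c' * f) ->
  prime_chain m 2.
Proof.
move=> hm f0 mf mg reg; have [mI m1 mM] := hm.
have regX i u c : u * g ^+ i = c * f -> exists c', u = c' * f.
  elim: i u c => [|i IH] u c; first by rewrite expr0 mulr1; exists c.
  by rewrite exprS mulrCA => /reg[c' /IH].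
have [||c [s' [i [hs' h]]]|P [hP Pf PW]] :=
    @exists_prime (fun s => exists s' i, ~ m s' /\ s = s' * g ^+ i) f.
- by exists 1, 0%N; rewrite expr0 mulr1.
- move=> s t [s' [i [hs ->]]] [t' [j [ht ->]]].
  exists (s' * t'), (i + j)%N; rewrite exprD mulrACA; split=> //.
  by case/mM.
- have [c' hc'] := regX _ _ _ (esym h); apply: hs'; rewrite hc'; exact: idealM.
exists (fun i => if i is i'.+1 then if i' is 0%N then P else m else (fun u => u = 0)).
split=> [[|[|i]] _ //|[|[|i]] // _|//]; first exact: zero_prime.
  have [PI _ _] := hP; split=> [u ->|]; first exact: ideal0.
  by move=> /(_ f Pf) /eqP; apply/negP.
split=> [u Pu|/(_ g mg)].
  by apply: contrapT => nu; apply: (PW u) => //; exists u, 0%N; rewrite expr0 mulr1.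
by apply: PW; exists 1, 1%N; rewrite expr1 mul1r.
Qed.

End PrimeAvoidance.

(** * Maximal ideals of finite extensions of k[u, v] *)

Section AlgebraicDependence.
Variables (k : fieldType) (A : comAlgType k).

(** [q] is the lowest nonzero coefficient of [Q] and [i] its index; the higher terms supply [a]. *)
Lemma lowest_term (B : nzRingType) (phi : {rmorphism B -> A}) (x : A) (Q : {poly B}) :
  Q != 0 -> exists q i a, q != 0 /\ (map_poly phi Q).[x] = x ^+ i * (phi q + a * x).
Proof.
elim/poly_ind: Q => [|Q c IH]; first by rewrite eqxx.
have ev : (map_poly phi (Q * 'X + c%:P)).[x] = (map_poly phi Q).[x] * x + phi c.
  by rewrite rmorphD rmorphM /= map_polyX map_polyC /= !hornerE.
have [c0|c0] := eqVneq c 0; last first.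
  by move=> _; exists c, 0%N, (map_poly phi Q).[x]; rewrite ev expr0 mul1r addrC.
rewrite c0 polyC0 addr0 rmorph0 addr0 in ev *.
have [->|Q0 _] := eqVneq Q 0; first by rewrite mul0r eqxx.
have [q [i [a [q0 h]]]] := IH Q0.
exists q, i.+1, a; split=> //; by rewrite ev h exprS; ring.
Qed.

Definition alg_dep (x0 x1 x2 : A) := exists Q : {poly {poly {poly k}}},
  Q != 0 /\ (map_poly (horner_eval x1 \o map_poly (horner_alg x2)) Q).[x0] = 0.

(** The lowest term is extracted once for each nested variable, [x0] being the outermost; the
    coefficient left at the end is a nonzero scalar and is normalized to 1. *)
Lemma alg_dep_lex x0 x1 x2 : alg_dep x0 x1 x2 -> lex_relation x0 x1 x2.
Proof.
case=> Q [Q0 hQ].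
have [q0 [i [a0 [nq0 h0]]]] := lowest_term (horner_eval x1 \o map_poly (horner_alg x2)) x0 Q0.
have [q1 [j [a1 [nq1 h1]]]] := lowest_term (horner_alg x2) x1 nq0.
have [c [l [a2 [nc h2]]]] := lowest_term (in_alg A) x2 nq1.
have ec : (c^-1)%:A * c%:A = 1 :> A by rewrite mulr_algl scalerA mulVf // scale1r.
exists i, j, l, ((c^-1)%:A * a0), ((c^-1)%:A * a1), ((c^-1)%:A * a2).
have e1 : horner_alg x2 q1 = x2 ^+ l * (c%:A + a2 * x2) by exact: h2.
have e0 : (horner_eval x1 \o map_poly (horner_alg x2)) q0 =
    x1 ^+ j * (x2 ^+ l * (c%:A + a2 * x2) + a1 * x1) by rewrite -e1; exact: h1.
have : x0 ^+ i * (x1 ^+ j * (x2 ^+ l * (c%:A + a2 * x2) + a1 * x1) + a0 * x0) = 0.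
  by rewrite -e0 -[RHS]hQ; exact/esym/h0.
move=> /(congr1 (fun z => (c^-1)%:A * z)); rewrite mulr0 => <-.
by rewrite -{1}ec; ring.
Qed.

Lemma dvdp_det (n : nat) (d : {poly k}) (M M' : 'M[{poly k}]_n) :
  (forall i j, d %| M i j - M' i j) -> d %| \det M - \det M'.
Proof.
move=> h; rewrite /determinant.
rewrite -sumrB; apply: (big_ind (fun z => is_true (d %| z))) => [|x y|s _].
- exact: dvdp0.
- exact: dvdp_add.
rewrite -mulrBr dvdp_mull //.
apply: (big_ind2 (fun x y => is_true (d %| x - y))); rewrite ?subrr ?dvdp0 // => x y x' y' hx hy.
have -> : x * x' - y * y' = (x - y) * x' + y * (x' - y') by ring.
by apply: dvdp_add; [apply: dvdp_mulr | apply: dvdp_mull].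
Qed.

(* If A/m were a finite module over k[X][1/h], containing k[X], then 1 + X h would
   be inverted by a matrix over k[X][1/h]; the determinant trick forbids it. *)
Lemma not_finite_over_localization (m : A -> Prop) (H : {rmorphism {poly k} -> A})
    (M : nat) (E : 'I_M -> A) (h : {poly k}) :
  maximal_ideal m -> h != 0 -> (forall f, m (H f) -> f = 0) ->
  (forall r, exists t (al : 'I_M -> {poly k}), m (H h ^+ t * r - \sum_j H (al j) * E j)) ->
  False.
Proof.
move=> hm h0 Hinj span; have [mI m1 _] := hm.
pose w := 1 + 'X * h.
have szw : (1 < size w)%N.
  have s2 : size ('X * h) = (size h).+1 by rewrite mulrC size_mulX.
  have h1 : (0 < size h)%N by rewrite size_poly_gt0.
  by rewrite /w addrC size_polyDl s2 ?size_poly1.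
have w0 : w != 0 by rewrite -size_poly_gt0 (leq_trans _ szw).
have [|g hg] := maximal_inverse (x := H w) hm.
  by move/Hinj/eqP; apply/negP.
have [ts hts] := choice (fun i : 'I_M => span (g * E i)).
have [al0 hal0] := choice hts.
pose t := (\sum_i ts i)%N.
pose al i j := h ^+ (t - ts i) * al0 i j.
have hal i : m (H h ^+ t * (g * E i) - \sum_j H (al i j) * E j).
  have le_t : (ts i <= t)%N by rewrite /t (bigD1 i) //= leq_addr.
  have -> : \sum_j H (al i j) * E j = H h ^+ (t - ts i) * \sum_j H (al0 i j) * E j.
    by rewrite mulr_sumr; apply: eq_bigr => j _; rewrite rmorphM rmorphXn mulrA.
  rewrite -{1}(subnK le_t) exprD -mulrA -mulrBr; exact: idealM.
(* Since [g] inverts [H w] modulo [m], the relation for [g * E i] becomes [h ^+ t] E_i = [w] times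
   the combination of the E_j given by [al]; so [D] kills the vector [E] modulo [m]. *)
pose D : 'M[{poly k}]_M := (h ^+ t)%:M - \matrix_(i, j) (w * al i j).
have hD i : m (\sum_j H (D i j) * E j).
  have -> : \sum_j H (D i j) * E j = H h ^+ t * E i - H w * \sum_j H (al i j) * E j.
    rewrite mulr_sumr (bigD1 i) //= [X in _ = _ - X](bigD1 i) //=.
    rewrite !mxE eqxx mulr1n rmorphB rmorphM rmorphXn /= mulrBl opprD addrA mulrA.
    congr (_ + _); rewrite -sumrN; apply: eq_bigr => j ji.
    by rewrite !mxE eq_sym (negPf ji) mulr0n sub0r rmorphN rmorphM /= mulNr mulrA.
  have -> : H h ^+ t * E i - H w * (\sum_j H (al i j) * E j) =
     H w * (H h ^+ t * (g * E i) - \sum_j H (al i j) * E j) -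
     (H h ^+ t * E i) * (g * H w - 1) by ring.
  by apply: idealB => //; apply: idealM.
have hdet i : m (H (\det D) * E i).
  have -> : H (\det D) * E i = \sum_l H ((\adj D) i l) * \sum_j H (D l j) * E j.
    under eq_bigr do rewrite mulr_sumr.
    rewrite exchange_big /= (bigD1 i) //=.
    have adjE j : \sum_l H ((\adj D) i l) * (H (D l j) * E j) = H ((\det D)%:M i j) * E j.
      rewrite -mul_adj_mx mxE rmorph_sum mulr_suml; apply: eq_bigr => l _.
      by rewrite rmorphM mulrA.
    rewrite adjE mxE eqxx mulr1n big1 ?addr0 // => j ji.
    by rewrite adjE mxE eq_sym (negPf ji) mulr0n rmorph0 mul0r.
  by apply: (ideal_sum _ mI) => l _; apply: idealM.
have detD : \det D = 0.
  have [s [be hbe]] := span 1.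
  have : m (H (\det D * h ^+ s)).
    rewrite rmorphM rmorphXn /= -[_ * _]mulr1 -mulrA.
    apply: (idealDr (y := - (H (\det D) * \sum_j H (be j) * E j)) mI); last first.
      by rewrite -mulrBr; apply: idealM.
    apply: idealN => //; rewrite mulr_sumr; apply: (ideal_sum _ mI) => j _.
    by rewrite mulrCA; apply: idealM.
  by move/Hinj/eqP; rewrite mulf_eq0 expf_eq0 (negPf h0) andbF orbF => /eqP.
(* Modulo [w] the matrix [D] is scalar, so [w] divides a power of [h]; but [w = 1 + 'X * h] is
   coprime to [h] and not constant. *)
have : w %| \det D - \det ((h ^+ t)%:M : 'M_M).
  apply: dvdp_det => i j; rewrite !mxE addrAC subrr add0r.
  by rewrite -mulNr; apply: dvdp_mulr; rewrite dvdpNr.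
rewrite detD sub0r dvdpNr det_scalar -exprM => hw.
have cop : coprimep w (h ^+ (t * M)).
  apply: coprimep_expr; apply/Bezout_eq1_coprimepP; exists (1, - 'X) => /=.
  by rewrite /w; ring.
by move: szw; have := coprimep_dvdl hw cop; rewrite coprimepp => /eqP ->.
Qed.

Hypothesis domA : forall x y : A, x * y = 0 -> x = 0 \/ y = 0.
Hypothesis depA : forall x0 x1 x2 : A, alg_dep x0 x1 x2.

(** Otherwise k[u] embeds in A/m. A nonzero [r] in [m] satisfies a relation with [v] and [u]; its
    lowest coefficient in [r] is a polynomial in [v] over k[u] that vanishes in A/m. Inverting its
    leading coefficient [h] makes [v] integral, so A/m is spanned over k[u][1/h] by finitely many
    v^j b_c, contrary to [not_finite_over_localization]. *)
Lemma zariski_free (u v : A) (n : nat) (b : 'I_n -> A) (m : A -> Prop) :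
  (forall P : A -> Prop, (forall x y, P x -> P y -> P (x + y)) ->
     (forall (c : k) x, P x -> P (c *: x)) -> (forall x, P x -> P (u * x)) ->
     (forall x, P x -> P (v * x)) -> (forall c, P (b c)) -> forall x, P x) ->
  maximal_ideal m -> (exists r, m r /\ r <> 0) ->
  exists f : {poly k}, f != 0 /\ m (horner_alg u f).
Proof.
move=> gen hm [r [mr r0]]; apply: contrapT => hn; have [mI m1 _] := hm.
pose H : {rmorphism {poly k} -> A} := horner_alg u.
have Hinj f : m (H f) -> f = 0.
  by move=> hf; apply: contrapT => /eqP f0; apply: hn; exists f.
have [Q [Q0 hQ]] := depA r v u.
have [q [i [a [q0 hq]]]] := lowest_term (horner_eval v \o map_poly H) r Q0.
have mq : m (map_poly H q).[v].
  have : r ^+ i * ((map_poly H q).[v] + a * r) = 0 by rewrite -[RHS]hQ; exact/esym/hq.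
  move=> h; have : (map_poly H q).[v] + a * r = 0.
    elim: i {hq} h => [|i IH]; first by rewrite expr0 mul1r.
    by rewrite exprS -mulrA => /domA[/r0|/IH].
  by move/eqP; rewrite addr_eq0 => /eqP ->; apply: idealN => //; apply: idealM.
pose e := (size q).-1; pose h := lead_coef q.
have sq : size q = e.+1 by rewrite prednK ?size_poly_gt0.
have h0 : h != 0 by rewrite lead_coef_eq0.
have {}mq : m (H h * v ^+ e + \sum_(j < e) H q`_j * v ^+ j).
  move: mq; rewrite (horner_coef_wide (n := size q)) ?size_poly // sq big_ord_recr /=.
  rewrite addrC coef_map -[h]/(q`_e).
  have -> : \sum_(j < e) (map_poly H q)`_j * v ^+ j = \sum_(j < e) H q`_j * v ^+ j.
    by apply: eq_bigr => j _; rewrite coef_map.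
  by [].
case: (posnP e) => [e0|e_gt0].
  move: mq; rewrite e0 big_ord0 addr0 expr0 mulr1 => /Hinj /eqP; exact/negP.
pose I := ('I_e * 'I_n)%type.
pose E (x : I) := v ^+ x.1 * b x.2.
(* Membership in the k[u][1/h]-span of [E] modulo [m], with the denominator cleared. *)
pose N r := exists t (al : I -> {poly k}), m (H h ^+ t * r - \sum_x H (al x) * E x).
have NE x : N (E x).
  exists 0%N, (fun y => (y == x)%:R); rewrite expr0 mul1r (bigD1 x) //= eqxx rmorph1 mul1r.
  rewrite opprD addrA subrr sub0r; apply: idealN => //.
  by apply: (ideal_sum _ mI) => y /negPf ->; rewrite rmorph0 mul0r; apply: ideal0.
have NH p x : N x -> N (H p * x).
  move=> [t [al hal]]; exists t, (fun y => p * al y).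
  have -> : \sum_y H (p * al y) * E y = H p * \sum_y H (al y) * E y.
    by rewrite mulr_sumr; apply: eq_bigr => y _; rewrite rmorphM mulrA.
  by rewrite mulrCA -mulrBr; apply: idealM.
have Nh x : N (H h * x) -> N x.
  by move=> [t [al hal]]; exists t.+1, al; rewrite exprSr -mulrA.
have Nht t x : N (H h ^+ t * x) -> N x.
  by elim: t => [|t IH]; rewrite ?expr0 ?mul1r // exprS -mulrA => /Nh.
have Nm x y : m (x - y) -> N x -> N y.
  move=> hxy [t [al hal]]; exists t, al.
  have -> : H h ^+ t * y - \sum_z H (al z) * E z =
    (H h ^+ t * x - \sum_z H (al z) * E z) - H h ^+ t * (x - y) by ring.
  by apply: idealB => //; apply: idealM.
have N0 : N 0.
  exists 0%N, (fun=> 0); rewrite mulr0 sub0r; apply: idealN => //.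
  by apply: (ideal_sum _ mI) => y _; rewrite rmorph0 mul0r; apply: ideal0.
have ND x y : N x -> N y -> N (x + y).
  move=> [t [al hal]] [t' [al' hal']].
  exists (t + t')%N, (fun z => h ^+ t' * al z + h ^+ t * al' z).
  have -> : \sum_z H (h ^+ t' * al z + h ^+ t * al' z) * E z =
     H h ^+ t' * (\sum_z H (al z) * E z) + H h ^+ t * \sum_z H (al' z) * E z.
    rewrite !mulr_sumr -big_split; apply: eq_bigr => z _ /=.
    by rewrite rmorphD !rmorphM !rmorphXn /=; ring.
  have -> : H h ^+ (t + t') * (x + y) -
     (H h ^+ t' * (\sum_z H (al z) * E z) + H h ^+ t * (\sum_z H (al' z) * E z)) =
     H h ^+ t' * (H h ^+ t * x - \sum_z H (al z) * E z) +
     H h ^+ t * (H h ^+ t' * y - \sum_z H (al' z) * E z) by rewrite exprD; ring.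
  by apply: idealD => //; apply: idealM.
have Nsum (T : Type) (s : seq T) (F : T -> A) : (forall z, N (F z)) -> N (\sum_(z <- s) F z).
  by move=> hF; apply: big_ind => //.
have NvE x : N (v * E x).
  case: x => i0 c; have [hi|hi] := ltnP i0.+1 e.
    by have := NE (Ordinal hi, c); rewrite /E /= exprS -mulrA.
  have ei : e = i0.+1 by apply/eqP; rewrite eqn_leq hi ltn_ord.
  apply: Nh; apply: (Nm (- \sum_(j < e) H q`_j * E (j, c))); last first.
    by rewrite -sumrN; apply: Nsum => j; rewrite -mulNr -rmorphN; apply: NH.
  have -> : - (\sum_(j < e) H q`_j * E (j, c)) - H h * (v * E (i0, c)) =
      - b c * (H h * v ^+ e + \sum_(j < e) H q`_j * v ^+ j).
    rewrite mulrDr mulr_sumr -!sumrN addrC; congr (_ + _).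
      have -> : v ^+ e = v ^+ i0.+1 by rewrite -ei.
      by rewrite /E /= exprS; ring.
    by apply: eq_bigr => j _; rewrite /E /=; ring.
  exact: idealM.
have Nv x : N x -> N (v * x).
  move=> [t [al hal]]; apply: (Nht t); apply: (Nm (\sum_z H (al z) * (v * E z))).
    have -> : \sum_z H (al z) * (v * E z) - H h ^+ t * (v * x) =
        - v * (H h ^+ t * x - \sum_z H (al z) * E z).
      rewrite mulrBr !mulr_sumr addrC -sumrN; congr (_ + _); first by ring.
      by apply: eq_bigr => z _; ring.
    exact: idealM.
  by apply: Nsum => z; apply/NH/NvE.
have Nall : forall x, N x.
  apply: gen => // [c x|x|c].
  - by move=> /(NH c%:P); rewrite /H /= horner_algC mulr_algl.
  - by move=> /(NH 'X); rewrite /H /= horner_algX.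
  - by have := NE (Ordinal e_gt0, c); rewrite /E /= expr0 mul1r.
apply: (not_finite_over_localization (H := H)
  (E := fun j : 'I_#|{: I}| => E (enum_val j)) hm h0 Hinj).
move=> x; have [t [al hal]] := Nall x.
exists t, (fun j => al (enum_val j)).
by rewrite (reindex _ (onW_bij _ (enum_val_bij _))) /= in hal.
Qed.

End AlgebraicDependence.

(** * Cohen-Macaulayness of finite free extensions of k[u, v] *)

Section FreeOverPolynomials.
Variables (k : fieldType) (A : comAlgType k).
Hypothesis noethA : noetherian A.
Hypothesis domA : forall x y : A, x * y = 0 -> x = 0 \/ y = 0.
Hypothesis depA : forall x0 x1 x2 : A, alg_dep x0 x1 x2.
Variables (u v : A) (n : nat) (b : 'I_n -> A).
Hypothesis genA : forall P : A -> Prop, (forall x y, P x -> P y -> P (x + y)) ->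
  (forall (c : k) x, P x -> P (c *: x)) -> (forall x, P x -> P (u * x)) ->
  (forall x, P x -> P (v * x)) -> (forall c, P (b c)) -> forall x, P x.

Definition ev2 (p : {poly {poly k}}) : A :=
  (horner_eval v \o map_poly (horner_alg u)) p.

Hypothesis freeA : forall p : 'I_n -> {poly {poly k}},
  \sum_c ev2 (p c) * b c = 0 -> forall c, p c = 0.

(** [f] involves only the inner variable and [g] only the outer one, so the leading coefficient of
    [g] is a scalar. Hence [f] divides the coefficients of [p] one after the other, from the top
    down. *)
Lemma poly_regular (f g : {poly k}) (p s : {poly {poly k}}) :
  g != 0 -> map_poly polyC g * p = f%:P * s -> exists p', p = f%:P * p'.
Proof.
move=> g0 h.
have dvd j i : (size p <= i + j)%N -> f %| p`_i.
  elim: j i => [|j IH] i; first by rewrite addn0 => /leq_sizeP -> //; rewrite dvdp0.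
  move=> hi; set d := (size g).-1.
  have sg : size g = d.+1 by rewrite prednK ?size_poly_gt0.
  have := congr1 (fun r : {poly {poly k}} => r`_(i + d)) h.
  rewrite /= coefCM coefM.
  have hd : (d < (i + d).+1)%N by lia.
  rewrite (bigD1 (Ordinal hd)) //= addnK coef_map /= => e.
  have : f %| (lead_coef g)%:P * p`_i.
    rewrite lead_coefE -/d -(dvdp_addl _ (_ : f %| \sum_(l < (i + d).+1 | l != Ordinal hd)
      (map_poly polyC g)`_l * p`_(i + d - l))) ?e ?dvdp_mulr //.
    apply: (big_ind (fun z => is_true (f %| z))) => [|x y|l nl]; [exact: dvdp0|exact: dvdp_add|].
    move: nl; rewrite -val_eqE /= => /eqP nl.
    have [ld|dl] := ltnP l d; first by apply/dvdp_mull/IH; lia.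
    rewrite coef_map nth_default ?polyC0 ?mul0r ?dvdp0 // sg ltn_neqAle eq_sym dl andbT.
    exact/eqP.
  by rewrite mul_polyC dvdpZr ?lead_coef_eq0.
exists (\poly_(i < size p) (p`_i %/ f)).
apply/polyP => i; rewrite coefCM coef_poly; case: ltnP => [_|hi].
  by rewrite mulrC divpK // (dvd (size p)) // leq_addl.
by rewrite mulr0 nth_default.
Qed.

Lemma ev2_map g : ev2 (map_poly polyC g) = horner_alg v g.
Proof.
rewrite /ev2 /= /horner_eval.
suff -> : map_poly (horner_alg u) (map_poly polyC g) = map_poly (in_alg A) g by [].
by apply/polyP => i; rewrite !coef_map /= horner_algC.
Qed.

Lemma ev2M p q : ev2 (p * q) = ev2 p * ev2 q. Proof. exact: rmorphM. Qed.

Lemma ev2B p q : ev2 (p - q) = ev2 p - ev2 q. Proof. exact: rmorphB. Qed.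

Lemma ev2C f : ev2 f%:P = horner_alg u f.
Proof. by rewrite /ev2 /= /horner_eval map_polyC hornerC. Qed.

Lemma coordinates x : exists p : 'I_n -> {poly {poly k}}, x = \sum_c ev2 (p c) * b c.
Proof.
elim/genA: x => [x y [p ->] [q ->]|c x [p ->]|x [p ->]|x [p ->]|c].
- exists (fun c => p c + q c); rewrite -big_split; apply: eq_bigr => c _ /=.
  by rewrite -mulrDl /ev2 rmorphD.
- exists (fun i => c%:P%:P * p i); rewrite scaler_sumr; apply: eq_bigr => i _.
  rewrite ev2M ev2C /= horner_algC.
  by rewrite mulr_algl scalerAl.
- exists (fun i => 'X%:P * p i); rewrite mulr_sumr; apply: eq_bigr => i _.
  by rewrite ev2M ev2C /= horner_algX mulrA.
- exists (fun i => 'X * p i); rewrite mulr_sumr; apply: eq_bigr => i _.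
  rewrite ev2M mulrA; congr (_ * _ * _).
  by rewrite /ev2 /= /horner_eval map_polyX hornerX.
- exists (fun i => (i == c)%:R); rewrite (bigD1 c) //= eqxx big1 ?addr0.
    by rewrite /ev2 rmorph1 mul1r.
  by move=> i /negPf ->; rewrite /ev2 rmorph0 mul0r.
Qed.

Lemma regular_pair (f g : {poly k}) r s : g != 0 ->
  horner_alg v g * r = s * horner_alg u f -> exists r', r = r' * horner_alg u f.
Proof.
move=> g0; have [p ->] := coordinates r; have [q ->] := coordinates s => h.
have e c : map_poly polyC g * p c - f%:P * q c = 0.
  apply: (freeA (p := fun c => map_poly polyC g * p c - f%:P * q c)).
  move/eqP: h; rewrite -subr_eq0 mulr_sumr mulr_suml -sumrB => /eqP h.
  rewrite -[RHS]h; apply: eq_bigr => i _.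
  rewrite ev2B !ev2M ev2C ev2_map; ring.
have [p' hp'] := choice (fun c => poly_regular g0 (subr0_eq (e c))).
exists (\sum_c ev2 (p' c) * b c); rewrite mulr_suml; apply: eq_bigr => c _.
by rewrite hp' ev2M ev2C; ring.
Qed.

Lemma horner_u_neq0 (f : {poly k}) : (0 < n)%N -> f != 0 -> horner_alg u f != 0.
Proof.
move=> n0; apply: contra_neq => h.
apply: polyC_inj; rewrite polyC0; apply: (freeA (p := fun=> f%:P) _ (Ordinal n0)).
by rewrite big1 // => c _; rewrite ev2C h mul0r.
Qed.

Lemma cohen_macaulay_of_free : (0 < n)%N -> u <> 0 -> (forall c, c * u <> 1) ->
  cohen_macaulay A.
Proof.
move=> n0 u0 nu; split=> // m hm; have mP := maximal_prime hm; have [mI m1 _] := mP.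
(* A zero [m] would be contained in the ideal generated by [u], which is proper as [u] is not
   invertible; maximality would then force [u = 0]. *)
have mne : exists r, m r /\ r <> 0.
  apply: contrapT => h; case: hm => _ _ hmax.
  have [||/(_ u) hu] := hmax _ (principal_ideal u).
  - move=> r mr; exists 0; rewrite mul0r; apply: contrapT => r0.
    by apply: h; exists r.
  - by move=> [c hc]; apply: (nu c).
  - by apply: h; exists u; split=> //; apply: hu; exists 1; rewrite mul1r.
have [f [f0 mf]] := zariski_free domA depA genA hm mne.
have genA' P := fun h1 h2 h3 h4 => @genA P h1 h2 h4 h3.
have [g [g0 mg]] := zariski_free domA depA genA' hm mne.
set fu := horner_alg u f in mf; set gv := horner_alg v g in mg.
have fu0 : fu != 0 by apply: horner_u_neq0.
have reg r s : gv * r = s * fu -> exists r', r = r' * fu by apply: regular_pair.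
have lexA (x0 x1 x2 : A) : lex_relation x0 x1 x2 := alg_dep_lex (depA x0 x1 x2).
exists 2%N; split; split.
- exact: prime_chain_regular mP fu0 mf mg reg.
- by move=> l; apply: prime_chain_le2.
- exists [:: fu; gv]; split=> //.
    by move=> x; rewrite !inE => /orP[] /eqP ->.
  split=> [[|[|i]] r //= _|].
  + move/ideal_gen_seqP=> [c]; rewrite big_ord0 => /domA [/eqP|->].
      by rewrite (negPf fu0).
    exact: ideal0 (ideal_gen_ideal _).
  + by move/ideal_gen1P=> [c /reg [r' ->]]; apply/ideal_gen1P; exists r'.
  + move=> /(_ m mI) h; apply: m1; apply: h => x.
    by rewrite !inE => /orP[] /eqP ->.
- by move=> l [s [<- _ /(regular_seq_le2 lexA)]].
Qed.

End FreeOverPolynomials.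

(** * Minimization of graded free resolutions *)

Section Resolution.
Variables (S A : comNzRingType) (eps : {rmorphism S -> A}).
Variables (J : finType) (hd : J -> nat) (aug : J -> A).

(** All homological degrees share the matrix [D] on a fixed index set [J], and [B] is the set of
    basis elements still present. Cancelling a pair then shrinks [B] without changing any matrix
    type. *)
Record resolves (B : {set J}) (D : J -> J -> S) : Prop := Resolves {
  resolves_hd : forall x y, D x y != 0 -> hd x = (hd y).+1;
  resolves_dd : {in B &, forall x z, \sum_(y in B) D x y * D y z = 0};
  resolves_augd : {in B, forall x, \sum_(y in B) eps (D x y) * aug y = 0};
  resolves_exact : forall u : J -> S,
    {in B, forall y, \sum_(x in B) u x * D x y = 0} ->
    \sum_(x in B) eps (u x) * aug x = 0 ->
    exists v : J -> S, {in B, forall x, u x = \sum_(z in B) v z * D z x};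
  resolves_surj : forall a : A, exists u : J -> S,
    a = \sum_(x in B) eps (u x) * aug x
}.

Lemma resolves_hd0 B D x : resolves B D -> D x x = 0.
Proof.
move=> hD; apply/eqP; apply: contraT => /(resolves_hd hD) h.
by move/eqP: h; rewrite -[X in X == _]addn0 -addn1 eqn_add2l.
Qed.

(** Gaussian elimination: the new differential is the Schur complement of the invertible entry
    [D l j]. *)
Lemma cancel_pivot (B : {set J}) (D : J -> J -> S) (l j : J) (e : S) :
  (forall x, hd x != 0%N -> aug x = 0) ->
  resolves B D -> l \in B -> j \in B -> e * D l j = 1 ->
  resolves (B :\ l :\ j) (fun x y => D x y - D x j * e * D l y).
Proof.
move=> haug hD lB jB ec.
have Dll := resolves_hd0 l hD; have Djj := resolves_hd0 j hD.
have nz : D l j != 0 by apply: contraTneq isT => z; rewrite z mulr0 in ec;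
  move/eqP: ec; rewrite eq_sym oner_eq0.
have hlj := resolves_hd hD nz.
have augl : aug l = 0 by apply: haug; rewrite hlj.
have jl : j != l by apply: contraTneq isT => z; move: nz; rewrite z Dll eqxx.
set B' := B :\ l :\ j.
have sB : {subset B' <= B} by move=> x; rewrite !inE => /and3P[].
have sumB (V : nmodType) (F : J -> V) :
    \sum_(x in B) F x = F l + (F j + \sum_(x in B') F x).
  by rewrite (big_setD1 l) //= (big_setD1 j) //= !inE jl.
have inB' x : x \in B -> x = l \/ x = j \/ x \in B'.
  by move=> xB; rewrite !inE xB andbT; case: (x =P l); case: (x =P j); auto.
have dd x z : x \in B -> z \in B -> \sum_(y in B') D x y * D y z =
    - (D x l * D l z) - D x j * D j z.
  move=> xB zB; have := resolves_dd hD xB zB; rewrite sumB => h.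
  by apply/eqP; rewrite -subr_eq0 -[X in _ == X]h; apply/eqP; ring.
split.
- move=> x y; have [->|nxy _] := eqVneq (D x y) 0; last exact: (resolves_hd hD).
  rewrite sub0r oppr_eq0 => h.
  have hx : D x j != 0 by apply: contraNneq h => ->; rewrite !mul0r.
  have hy : D l y != 0 by apply: contraNneq h => ->; rewrite !mulr0.
  by rewrite (resolves_hd hD hx) -hlj (resolves_hd hD hy).
- move=> x z xB zB; have xB1 := sB _ xB; have zB1 := sB _ zB.
  have -> : \sum_(y in B') (D x y - D x j * e * D l y) *
      (D y z - D y j * e * D l z) =
      \sum_(y in B') D x y * D y z - (\sum_(y in B') D x y * D y j) * (e * D l z)
      - D x j * e * (\sum_(y in B') D l y * D y z)
      + D x j * e * (\sum_(y in B') D l y * D y j) * (e * D l z).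
    rewrite !(mulr_suml, mulr_sumr) -!sumrB -big_split /=.
    by apply: eq_bigr => y _; ring.
  rewrite !dd // Dll Djj.
  transitivity ((e * D l j - 1) * (D x l * D l z + D x j * D j z)); first by ring.
  by rewrite ec subrr mul0r.
- move=> x xB; have xB1 := sB _ xB.
  have := resolves_augd hD xB1; have := resolves_augd hD lB.
  rewrite !sumB Dll augl rmorph0 mul0r mulr0 !add0r => hl hx.
  have -> : \sum_(y in B') eps (D x y - D x j * e * D l y) * aug y =
      \sum_(y in B') eps (D x y) * aug y
      - eps (D x j * e) * \sum_(y in B') eps (D l y) * aug y.
    rewrite mulr_sumr -sumrB; apply: eq_bigr => y _.
    by rewrite rmorphB rmorphM; ring.
  move/eqP: hl; rewrite addrC addr_eq0 => /eqP ->.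
  move/eqP: hx; rewrite addrC addr_eq0 => /eqP ->.
  by rewrite mulrN opprK mulrA -rmorphM -mulrA ec mulr1 addNr.
- move=> u hu hau.
  (* A cycle [u] of the smaller complex is lifted to [B]: it is 0 on [j], and [w] on [l] is the
     value that cancels the coordinate [j] of its boundary. *)
  pose w := - (e * \sum_(x in B') u x * D x j).
  pose U x := if x == l then w else if x == j then 0 else u x.
  have Ul : U l = w by rewrite /U eqxx.
  have Uj : U j = 0 by rewrite /U (negPf jl) eqxx.
  have UB x : x \in B' -> U x = u x.
    by rewrite !inE /U => /and3P[/negPf -> /negPf ->].
  have sumU (V : nmodType) (F : S -> J -> V) :
      \sum_(x in B') F (U x) x = \sum_(x in B') F (u x) x.
    by apply: eq_bigr => x xB; rewrite UB.
  pose DU y := \sum_(x in B) U x * D x y.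
  have DUE y : DU y = w * D l y + \sum_(x in B') u x * D x y.
    by rewrite /DU sumB Ul Uj mul0r add0r (sumU _ (fun a x => a * D x y)).
  have DUj : DU j = 0.
    by rewrite DUE /w; set s := \sum_(x in B') _; rewrite mulNr mulrAC ec mul1r addNr.
  have DUB y : y \in B' -> DU y = 0.
    move=> yB; rewrite -[RHS](hu y yB) DUE /w.
    have -> : \sum_(x in B') u x * (D x y - D x j * e * D l y) =
        \sum_(x in B') u x * D x y - (\sum_(x in B') u x * D x j) * e * D l y.
      by rewrite !mulr_suml -sumrB; apply: eq_bigr => x _; ring.
    ring.
  (* Only the coordinate [l] of the boundary can be left; as the differential squares to zero and
     [D l j] is a unit, it vanishes too. *)
  have DUl : DU l = 0.
    have : \sum_(y in B) DU y * D y j = 0.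
      rewrite /DU; under eq_bigr do rewrite mulr_suml.
      rewrite exchange_big /= big1 // => x xB.
      under eq_bigr do rewrite -mulrA.
      by rewrite -mulr_sumr (resolves_dd hD) ?mulr0.
    rewrite sumB DUj mul0r add0r big1 ?addr0; last first.
      by move=> y yB; rewrite DUB // mul0r.
    by move=> /(congr1 (fun a => a * e)); rewrite mul0r -mulrA [_ * e]mulrC ec mulr1.
  have [v hv] : exists v : J -> S, {in B, forall x, U x = \sum_(z in B) v z * D z x}.
    apply: (resolves_exact hD) => [y /inB' [->|[->|]] //|]; first exact: DUB.
    rewrite sumB augl mulr0 Uj rmorph0 mul0r !add0r.
    by rewrite (sumU _ (fun a x => eps a * aug x)).
  (* The smaller complex is the quotient by [l] and its boundary, where [j] becomes [- e] times the
     rest of the boundary of [l]; this is the image of [v]. The surjectivity below uses the same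
     map. *)
  exists (fun z => v z - e * v j * D l z) => x xB.
  have xB1 := sB _ xB.
  have := hv j jB; rewrite Uj sumB Djj mulr0 add0r => hvj.
  have := hv x xB1; rewrite UB // sumB => ->.
  have -> : \sum_(z in B') (v z - e * v j * D l z) * (D z x - D z j * e * D l x) =
      \sum_(z in B') v z * D z x - (\sum_(z in B') v z * D z j) * e * D l x
      - e * v j * (\sum_(z in B') D l z * D z x)
      + e * v j * (\sum_(z in B') D l z * D z j) * e * D l x.
    rewrite !(mulr_suml, mulr_sumr, mulr_suml) -!sumrB -big_split /=.
    by apply: eq_bigr => z _; ring.
  rewrite !dd // Dll Djj.
  have -> : \sum_(z in B') v z * D z j = - (v l * D l j).
    by apply/eqP; rewrite -addr_eq0 addrC -hvj.
  apply/eqP; rewrite -subr_eq0; apply/eqP.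
  transitivity ((1 - e * D l j) * (v l * D l x + v j * D j x)); first by ring.
  by rewrite ec subrr mul0r.
- move=> a; have [u hu] := resolves_surj hD a.
  exists (fun x => u x - u j * e * D l x).
  have := resolves_augd hD lB.
  rewrite hu !sumB Dll augl !mulr0 !add0r => hl.
  have -> : \sum_(x in B') eps (u x - u j * e * D l x) * aug x =
     \sum_(x in B') eps (u x) * aug x - eps (u j * e) * \sum_(x in B') eps (D l x) * aug x.
    rewrite mulr_sumr -sumrB; apply: eq_bigr => y _.
    by rewrite rmorphB rmorphM; ring.
  move/eqP: hl; rewrite addrC addr_eq0 => /eqP ->.
  by rewrite mulrN opprK mulrA -rmorphM -mulrA ec mulr1 addrC.
Qed.

End Resolution.

(** * Cancelling the units of a graded resolution *)

Section Minimization.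
Variables (k : fieldType) (N : nat).
Local Notation S := {mpoly k[N]}.

(** Homogeneity of degree [s - t] without truncated subtraction: for [s < t] it forces [p = 0]. *)
Definition gdeg (p : S) (s t : nat) := {in msupp p, forall m, (mdeg m + t)%N = s}.

Lemma gdeg0 s t : gdeg 0 s t.
Proof. by move=> m; rewrite mcoeff_msupp mcoeff0 eqxx. Qed.

Lemma gdegC (c : k) s : gdeg c%:MP s s.
Proof.
by move=> m; rewrite msuppC; case: ifP => // _; rewrite inE => /eqP ->; rewrite mdeg0.
Qed.

Lemma gdegM p q s t w : gdeg p s t -> gdeg q t w -> gdeg (p * q) s w.
Proof.
move=> hp hq m /msuppM_le /allpairsP[[m1 m2] /= [h1 h2 ->]].
by rewrite mdegD -addnA (hq _ h2) (hp _ h1).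
Qed.

Lemma gdegD p q s t : gdeg p s t -> gdeg q s t -> gdeg (p + q) s t.
Proof. by move=> hp hq m /msuppD_le; rewrite mem_cat => /orP[/hp|/hq]. Qed.

Lemma gdegN p s t : gdeg p s t -> gdeg (- p) s t.
Proof. by move=> hp m; rewrite (perm_mem (msuppN p)); apply: hp. Qed.

Lemma gdeg_const p s t : gdeg p s t -> p@_0%MM != 0 ->
  s = t /\ p = (p@_0%MM)%:MP.
Proof.
move=> hp; rewrite -mcoeff_msupp => h0; have := hp _ h0; rewrite mdeg0 => st.
split=> //; apply/mpolyP=> m; rewrite mcoeffC.
have [->|nm] := eqVneq m 0%MM; first by rewrite mulr1.
rewrite mulr0; apply/eqP; rewrite mcoeff_eq0; apply: contra nm => /hp.
by rewrite -st -[X in _ = X]add0n => /addIn /eqP; rewrite mdeg_eq0.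
Qed.

Variables (A : comNzRingType) (eps : {rmorphism S -> A}).
Variables (J : finType) (hd dg : J -> nat) (aug : J -> A).
Hypothesis aug_hd : forall x, hd x != 0%N -> aug x = 0.

(** By homogeneity an entry with nonzero constant term is a scalar, hence a pivot, and joins two
    basis elements of equal degree in consecutive homological degrees. An element with no such
    partner is never cancelled, which is the last clause. *)
Lemma minimize (B : {set J}) (D : J -> J -> S) :
  resolves eps hd aug B D -> (forall x y, gdeg (D x y) (dg x) (dg y)) ->
  exists (B' : {set J}) (D' : J -> J -> S),
    [/\ B' \subset B, resolves eps hd aug B' D',
        forall x y, gdeg (D' x y) (dg x) (dg y),
        {in B' &, forall x y, (D' x y)@_0%MM = 0}
      & {in B, forall x,
          {in B, forall y, hd x = (hd y).+1 \/ hd y = (hd x).+1 -> dg y <> dg x} ->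
          x \in B'}].
Proof.
have [n] := ubnP #|B|; elim: n B D => // n IH B D ltBn hD hg.
have [/existsP[l /andP[lB /existsP[j /andP[jB nz]]]]|/existsPn h] :=
  boolP [exists l in B, exists j in B, (D l j)@_0%MM != 0]; last first.
  exists B, D; split=> // x y xB yB; have := h x; rewrite xB /= => /existsPn/(_ y).
  by rewrite yB negbK => /eqP.
have [eq_dg Dlj] := gdeg_const (hg l j) nz.
have ec : ((D l j)@_0%MM)^-1%:MP * D l j = 1.
  by rewrite {2}Dlj -rmorphM /= mulVf // rmorph1.
have nzD : D l j != 0 by apply: contraNneq nz => ->; rewrite mcoeff0.
have hlj := resolves_hd hD nzD.
have lj : j != l by apply: contraTneq isT => z; move: hlj; rewrite z; lia.
have [||B' [D' [sB hD' hg' hm' pr]]] := IH _ _ _ (cancel_pivot aug_hd hD lB jB ec).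
- by move: ltBn; rewrite (cardsD1 l B) lB (cardsD1 j (B :\ l)) !inE lj jB; lia.
- move=> x y; apply: gdegD; first exact: hg.
  apply: gdegN; apply: (gdegM _ (hg l y)).
  by apply: (gdegM (hg x j)); rewrite eq_dg; exact: gdegC.
exists B', D'; split=> //.
  apply: (subset_trans sB); apply/subsetP => x; rewrite !inE; by case/and3P.
move=> x xB hx; apply: pr; last first.
  by move=> y; rewrite !inE => /and3P[_ _ yB]; apply: hx.
rewrite !inE xB andbT; apply/andP; split; apply/eqP => z.
  by apply: (hx l lB); rewrite z //; right.
by apply: (hx j jB); rewrite z //; left.
Qed.

End Minimization.

(** * From a minimal one-matrix resolution to the regularity *)

Section Record.
Variables (k : fieldType) (A : comAlgType k) (gr : nat -> A -> Prop).
Variables (N : nat) (t : 'I_N -> A).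
Local Notation S := {mpoly k[N]}.

Definition eval_rmorph : {rmorphism S -> A} := mmap (in_alg A) t.

Variables (J : finType) (hd dg : J -> nat) (aug : J -> A).
Hypothesis aug_hd : forall x, hd x != 0%N -> aug x = 0.

Section Ext.
Variables (B : {set J}).
Definition layer (i : nat) : {set J} := [set x in B | hd x == i].
(** Extension by zero of a vector on one layer to all of [J]; the sum has at most one term. *)
Definition ext (i : nat) (u : 'rV[S]_#|layer i|) (x : J) : S :=
  \sum_(l | enum_val l == x) u 0 l.

Lemma ext_val (i : nat) (u : 'rV[S]_#|layer i|) l : ext u (enum_val l : J) = u 0 l :> S.
Proof.
by rewrite /ext (big_pred1 l) // => l'; rewrite (inj_eq enum_val_inj).
Qed.

Lemma ext_out (i : nat) (u : 'rV[S]_#|layer i|) x : x \notin layer i -> ext u x = 0.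
Proof.
move=> h; rewrite /ext big_pred0 // => l; apply: contraNF h => /eqP <-.
exact: enum_valP.
Qed.

Lemma sum_ext (V : nmodType) (i : nat) (u : 'rV[S]_#|layer i|) (F : S -> J -> V) :
  (forall x, F 0 x = 0) ->
  \sum_(x in B) F (ext u x) x = \sum_l F (u 0 l) (enum_val l).
Proof.
move=> F0; rewrite (bigID (mem (layer i))) /= addrC big1 ?add0r; last first.
  by move=> x /andP[_ /ext_out ->].
rewrite (eq_bigl (mem (layer i))); last first.
  by move=> x; rewrite !inE; case: (x \in B).
by rewrite big_enum_val; apply: eq_bigr => l _; rewrite ext_val.
Qed.

Lemma sum_layer (V : nmodType) (i : nat) (F : J -> V) :
  {in B, forall x, hd x != i -> F x = 0} ->
  \sum_(x in B) F x = \sum_(l < #|layer i|) F (enum_val l).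
Proof.
move=> h; rewrite (bigID (mem (layer i))) /= addrC big1 ?add0r; last first.
  by move=> x /andP[xB]; rewrite inE xB; apply: h.
rewrite (eq_bigl (mem (layer i))); last first.
  by move=> x; rewrite !inE; case: (x \in B).
by rewrite big_enum_val.
Qed.

Lemma layerP (i : nat) (l : 'I_#|layer i|) :
  enum_val l \in B /\ hd (enum_val l) = i.
Proof. by have := enum_valP l; rewrite inE => /andP[-> /eqP]. Qed.

End Ext.

Lemma minimal_regularity (B : {set J}) (D : J -> J -> S) L r p :
  resolves eval_rmorph hd aug B D ->
  (forall x y, gdeg (D x y) (dg x) (dg y)) ->
  {in B &, forall x y, (D x y)@_0%MM = 0} ->
  {in B, forall x, hd x <= L}%N -> {in B, forall x, dg x <= r + hd x}%N ->
  p \in B -> hd p = L -> dg p = (r + L)%N ->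
  {in B, forall x, hd x = 0%N -> gr (dg x) (aug x)} ->
  regularity gr t r%:Z.
Proof.
move=> hD hg hm hL hr pB hp dp hgr.
have D0 x y : hd x != (hd y).+1 -> D x y = 0.
  by move=> h; apply/eqP; apply: contraNT h => /(resolves_hd hD) ->.
pose rk i := #|layer B i|.
pose df i : 'M[S]_(rk i.+1, rk i) := \matrix_(l, j) D (enum_val l) (enum_val j).
pose dgi i (l : 'I_(rk i)) := dg (enum_val l).
pose au (l : 'I_(rk 0)) := aug (enum_val l).
have D_ext i (u : 'rV_(rk i.+1)) (y : 'I_(rk i)) :
    \sum_(x in B) ext u x * D x (enum_val y) = (u *m df i) 0 y.
  rewrite (sum_ext u (F := fun a x => a * D x (enum_val y))) => [|x]; last by rewrite mul0r.
  by rewrite mxE; apply: eq_bigr => l _; rewrite mxE.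
have D_res i (v : J -> S) (y : 'I_(rk i)) :
    \sum_(x in B) v x * D x (enum_val y) = ((\row_l v (enum_val l)) *m df i) 0 y.
  rewrite (sum_layer (i := i.+1)).
    by rewrite mxE; apply: eq_bigr => l _; rewrite !mxE.
  by move=> x xB hx; rewrite D0 ?mulr0 //; have [_ ->] := layerP y.
have dd i : df i.+1 *m df i = 0.
  apply/matrixP => l j; rewrite !mxE.
  have [lB hl] := layerP l; have [jB hj] := layerP j.
  rewrite -[RHS](resolves_dd hD lB jB) (sum_layer (i := i.+1)).
    by apply: eq_bigr => q _; rewrite !mxE.
  by move=> x xB hx; rewrite [D x _]D0 ?mulr0 // hj.
have exactS i (u : 'rV[S]_(rk i.+1)) :
    u *m df i = 0 <-> exists v : 'rV[S]_(rk i.+2), u = v *m df i.+1.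
  split=> [hu|[v ->]]; last by rewrite -mulmxA dd mulmx0.
  have [||v hv] := resolves_exact hD (u := ext u).
  - move=> y yB; have [hy|hy] := eqVneq (hd y) i.
      have yl : y \in layer B i by rewrite inE yB hy eqxx.
      by rewrite -(enum_rankK_in yl yl) D_ext hu mxE.
    rewrite big1 // => x xB.
    have [xl|/ext_out -> ] := boolP (x \in layer B i.+1); last by rewrite mul0r.
    rewrite D0 ?mulr0 //; move: xl; rewrite inE => /andP[_ /eqP ->].
    by rewrite eqSS eq_sym.
  - rewrite big1 // => x xB.
    have [xl|/ext_out -> ] := boolP (x \in layer B i.+1); last by rewrite rmorph0 mul0r.
    by rewrite aug_hd ?mulr0 //; move: xl; rewrite inE => /andP[_ /eqP ->].
  exists (\row_l v (enum_val l)); apply/rowP => l.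
  have [lB _] := layerP l.
  by rewrite -D_res -hv // ext_val.
(* Descending from the layer of [p]: if layer i' were empty and the next one not, a basis vector of
   the latter would be a cycle, hence a boundary, but by minimality boundaries have zero constant
   terms. *)
have rkP i : (0 < rk i)%N = (i <= L)%N.
  apply/idP/idP => [/card_gt0P[x]|].
    by rewrite inE => /andP[xB /eqP <-]; apply: hL.
  move=> iL; rewrite -(subKn iL); elim: (L - i)%N => [|e IH].
    by rewrite subn0; apply/card_gt0P; exists p; rewrite inE pB hp eqxx.
  have [eL|Le] := ltnP e L; last first.
    by rewrite (_ : L - e.+1 = L - e)%N //; lia.
  have [i' hi] : exists i', (L - e)%N = i'.+1 by exists (L - e).-1; lia.
  rewrite subnS; rewrite hi in IH *; rewrite lt0n /=; apply/negP => /eqP z.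
  pose l0 : 'I_(rk i'.+1) := Ordinal IH.
  have [|v hv] := (exactS i' (delta_mx 0 l0)).1.
    by apply/rowP => y; have := ltn_ord y; rewrite {2}z.
  have := congr1 (fun M : 'M_(_, _) => (M 0 l0)@_0%MM) hv.
  rewrite /= !mxE !eqxx /= mcoeff1 eqxx => /eqP; rewrite raddf_sum big1 ?oner_eq0 //=.
  move=> q _; rewrite !mxE rmorphM /= hm ?mulr0 //; first by have [] := layerP q.
  by have [] := layerP l0.
have exact0 (u : 'rV[S]_(rk 0)) : \sum_j gen_eval t (u 0 j) * au j = 0 <->
    exists v : 'rV[S]_(rk 1), u = v *m df 0.
  split=> [hu|[v ->]].
    have [||v hv] := resolves_exact hD (u := ext u).
    - move=> y yB; rewrite (sum_ext u (F := fun a x => a * D x y)) => [|x]; last by rewrite mul0r.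
      rewrite big1 // => l _; rewrite D0 ?mulr0 //.
      by have [_ ->] := layerP l.
    - rewrite (sum_ext u (F := fun a x => eval_rmorph a * aug x)) // => x.
      by rewrite rmorph0 mul0r.
    exists (\row_l v (enum_val l)); apply/rowP => l.
    have [lB _] := layerP l.
    by rewrite -D_res -hv // ext_val.
  pose V := ext (i := 1) v.
  transitivity (\sum_(j < rk 0)
     eval_rmorph (\sum_(x in B) V x * D x (enum_val j)) * aug (enum_val j)).
    by apply: eq_bigr => j _; rewrite D_ext.
  have <- := sum_layer (B := B) (i := 0%N)
    (F := fun y => eval_rmorph (\sum_(x in B) V x * D x y) * aug y); last first.
    by move=> y _ hy; rewrite aug_hd ?mulr0.
  under eq_bigr do rewrite rmorph_sum mulr_suml /=.
  rewrite exchange_big big1 //= => x xB.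
  under eq_bigr do rewrite rmorphM -mulrA /=.
  by rewrite -mulr_sumr (resolves_augd hD) ?mulr0.
have surj (a : A) : exists u : 'rV[S]_(rk 0), a = \sum_j gen_eval t (u 0 j) * au j.
  have [u ->] := resolves_surj hD a.
  exists (\row_l u (enum_val l)); rewrite (sum_layer (i := 0%N)).
    by apply: eq_bigr => j _; rewrite mxE.
  by move=> y _ hy; rewrite aug_hd ?mulr0.
have hau (j : 'I_(rk 0)) : gr (dgi 0%N j) (au j).
  by have [jB hj] := layerP j; apply: hgr.
have hdf i (l : 'I_(rk i.+1)) (j : 'I_(rk i)) :
    ((dgi i j <= dgi i.+1 l)%N -> df i l j \is (dgi i.+1 l - dgi i j).-homog) /\
    ((dgi i.+1 l < dgi i j)%N -> df i l j = 0).
  rewrite mxE; have hlj := hg (enum_val l) (enum_val j); split=> h.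
    apply/dhomogP => m /hlj; rewrite /= -/(dgi i j) -/(dgi i.+1 l) => <-.
    by rewrite addnK.
  apply/msuppnil0; case E : (msupp _) => [//|m s].
  have := hlj m; rewrite E mem_head => /(_ isT); move: h; rewrite /dgi; lia.
have hmin i l j : (df i l j)@_0%MM = 0.
  rewrite mxE; have [lB _] := layerP l; have [jB _] := layerP j; exact: hm.
pose F := @MinGradedFreeRes k A gr N t L rk dgi df au rkP hau hdf surj exact0 exactS hmin.
exists F; rewrite /fr_reg /=.
have le_r i : (fr_maxdeg F i <= r + i)%N.
  apply/bigmax_leqP => l _; rewrite /= /dgi; have [lB hl] := layerP l.
  by rewrite -[X in (_ <= _ + X)%N]hl; apply: hr.
apply/eqP; rewrite eq_le; apply/andP; split; last first.
  apply: bigmax_le => [|i _]; first by rewrite lez_nat -[X in (_ <= X)%N]addn0.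
  by rewrite lerBlDr -PoszD lez_nat.
have pl : p \in layer B L by rewrite inE pB hp eqxx.
apply: (le_trans _ (le_bigmax _ _ (ord_max : 'I_L.+1))) => /=.
rewrite lerBrDr -PoszD lez_nat -dp -(enum_rankK_in pl pl).
exact: (leq_bigmax (F := dgi L)).
Qed.

Lemma resolution_regularity (B : {set J}) (D : J -> J -> S) L r p :
  resolves eval_rmorph hd aug B D ->
  (forall x y, gdeg (D x y) (dg x) (dg y)) ->
  {in B, forall x, hd x <= L}%N -> {in B, forall x, dg x <= r + hd x}%N ->
  p \in B -> hd p = L -> dg p = (r + L)%N ->
  {in B, forall x, hd x = 0%N -> gr (dg x) (aug x)} ->
  regularity gr t r%:Z.
Proof.
move=> hD hg hL hr pB hp dp hgr.
have [B' [D' [/subsetP sB hD' hg' hm' pr]]] := minimize aug_hd hD hg.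
apply: (minimal_regularity (p := p) hD' hg' hm' _ _ _ hp dp) => [x xB|x xB||x xB].
- exact: hL (sB _ xB).
- exact: hr (sB _ xB).
- apply: pr => // y yB; have := hL y yB; have := hr y yB; lia.
- exact: hgr (sB _ xB).
Qed.

End Record.

(** * Koszul complexes of commuting matrices *)

Section Koszul.
Variables (S : comNzRingType) (n : nat).
Implicit Types (l : seq 'M[S]_n) (Z psi : 'M[S]_n).

Fixpoint kos_size l : nat :=
  if l is _ :: l' then (kos_size l' + kos_size l')%N else n.

Fixpoint kos_diag l Z : 'M[S]_(kos_size l) :=
  match l with
  | [::] => Z
  | _ :: l' => block_mx (kos_diag l' Z) 0 0 (kos_diag l' Z)
  end.

(* The Koszul complex as one square matrix: the Koszul complex of [psi :: l] is
   the mapping cone of [psi] acting on that of [l]. *)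
Fixpoint kos_diff l : 'M[S]_(kos_size l) :=
  match l with
  | [::] => 0
  | psi :: l' => block_mx (kos_diff l') 0 (kos_diag l' psi) (- kos_diff l')
  end.

Fixpoint kos_hd l : 'I_(kos_size l) -> nat :=
  match l with
  | [::] => fun=> 0%N
  | _ :: l' => fun x =>
      match split x with inl y => kos_hd y | inr y => (kos_hd y).+1 end
  end.

Fixpoint kos_base l : 'I_(kos_size l) -> 'I_n :=
  match l with
  | [::] => id
  | _ :: l' => fun x =>
      match split x with inl y => kos_base y | inr y => kos_base y end
  end.

Fixpoint kos_proj l : 'rV[S]_(kos_size l) -> 'rV[S]_n :=
  match l with
  | [::] => id
  | _ :: l' => fun u => kos_proj (lsubmx u)
  end.

Fixpoint kos_incl l (w : 'rV[S]_n) : 'rV[S]_(kos_size l) :=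
  match l with
  | [::] => w
  | _ :: l' => row_mx (kos_incl l' w) 0
  end.

(** The sum of the images of the members of [l], that is, the boundaries in homological degree 0. *)
Fixpoint kos_im l (w : 'rV[S]_n) : Prop :=
  match l with
  | [::] => w = 0
  | psi :: l' => exists w', kos_im l' (w - w' *m psi)
  end.

Fixpoint kos_regular l : Prop :=
  match l with
  | [::] => True
  | psi :: l' => kos_regular l' /\ forall w, kos_im l' (w *m psi) -> kos_im l' w
  end.

Lemma kos_projD l : {morph @kos_proj l : u v / u + v}.
Proof. by elim: l => [|psi l IH] //= u v; rewrite raddfD IH. Qed.

Lemma kos_projN l : {morph @kos_proj l : u / - u}.
Proof. by elim: l => [|psi l IH] //= u; rewrite raddfN IH. Qed.

Lemma kos_im0 l : kos_im l 0.
Proof. by elim: l => [|psi l IH] //=; exists 0; rewrite mul0mx subr0. Qed.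

Lemma kos_imD l u v : kos_im l u -> kos_im l v -> kos_im l (u + v).
Proof.
elim: l u v => [|psi l IH] /= u v; first by move=> -> ->; rewrite addr0.
move=> [u' hu] [v' hv]; exists (u' + v').
by rewrite mulmxDl opprD addrACA; apply: IH.
Qed.

Lemma kos_imN l u : kos_im l u -> kos_im l (- u).
Proof.
elim: l u => [|psi l IH] /= u; first by move=> ->; rewrite oppr0.
by move=> [u' hu]; exists (- u'); rewrite mulNmx -opprD; apply: IH.
Qed.

Lemma kos_imM l Z u : {in l, forall Y, Y *m Z = Z *m Y} ->
  kos_im l u -> kos_im l (u *m Z).
Proof.
elim: l u => [|psi l IH] /= u; first by move=> _ ->; rewrite mul0mx.
move=> hc [u' hu]; exists (u' *m Z).
rewrite -mulmxA -hc ?mem_head // mulmxA -mulmxBl; apply: IH hu.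
by move=> Y Yl; apply: hc; rewrite inE Yl orbT.
Qed.

Lemma kos_im_mem l psi w : psi \in l -> kos_im l (w *m psi).
Proof.
elim: l => [//|phi l IH] /=; rewrite inE => /orP[/eqP <-|/IH h].
  by exists w; rewrite subrr; apply: kos_im0.
by exists 0; rewrite mul0mx subr0.
Qed.

Lemma kos_diagM l Z Y : kos_diag l (Z *m Y) = kos_diag l Z *m kos_diag l Y.
Proof.
elim: l => [|psi l IH] //=.
by rewrite mulmx_block !mul0mx !mulmx0 !addr0 add0r IH.
Qed.

Lemma kos_diag_comm l Z : {in l, forall Y, Y *m Z = Z *m Y} ->
  kos_diag l Z *m kos_diff l = kos_diff l *m kos_diag l Z.
Proof.
elim: l => [|psi l IH] /= hc; first by rewrite mul0mx mulmx0.
rewrite !mulmx_block !mul0mx !mulmx0 !addr0 !add0r -!kos_diagM.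
rewrite hc ?mem_head // mulmxN mulNmx IH // => Y Yl.
by apply: hc; rewrite inE Yl orbT.
Qed.

Definition commuting l := {in l &, forall Y Z, Y *m Z = Z *m Y}.

Lemma commuting_cons psi l : commuting (psi :: l) ->
  commuting l /\ {in l, forall Y, Y *m psi = psi *m Y}.
Proof.
move=> h; split=> [Y Z hY hZ|Y hY]; apply: h; rewrite !inE ?hY ?hZ ?orbT ?eqxx //.
Qed.

Lemma kos_diff2 l : commuting l -> kos_diff l *m kos_diff l = 0.
Proof.
elim: l => [|psi l IH] /= hc; first by rewrite mulmx0.
have [hl hp] := commuting_cons hc.
rewrite mulmx_block !mul0mx !mulmx0 !addr0 !add0r !mulmxN !mulNmx opprK IH //.
by rewrite kos_diag_comm // subrr block_mx0.
Qed.

Lemma kos_proj_diag l Z u : kos_proj (u *m kos_diag l Z) = kos_proj u *m Z.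
Proof.
elim: l u => [|psi l IH] //= u.
by rewrite -{1}[u]hsubmxK mul_row_block row_mxKl mulmx0 addr0 IH.
Qed.

Lemma kos_inclK l w : kos_proj (kos_incl l w) = w.
Proof. by elim: l => [|psi l IH] //=; rewrite row_mxKl. Qed.

Lemma kos_incl_diff l w : kos_incl l w *m kos_diff l = 0.
Proof.
elim: l => [|psi l IH] /=; first by rewrite mulmx0.
by rewrite mul_row_block IH !mul0mx mulmx0 !addr0 row_mx0.
Qed.

Lemma kos_proj_diff l v : kos_im l (kos_proj (v *m kos_diff l)).
Proof.
elim: l v => [|psi l IH] /= v; first by rewrite mulmx0.
rewrite -[v]hsubmxK mul_row_block row_mxKl kos_projD kos_proj_diag.
by exists (kos_proj (rsubmx v)); rewrite addrK.
Qed.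

(** The long exact sequence of the mapping cone by hand: regularity of [psi] makes the degree 0 part
    of [u1] a boundary, so [u1] has a preimage, and what then remains of [u0] is again a cycle of
    the tail. The condition on [kos_proj u] makes room for degree 0, where every vector is a
    cycle. *)
Lemma kos_exact l u : commuting l -> kos_regular l -> u *m kos_diff l = 0 ->
  kos_im l (kos_proj u) -> exists v, u = v *m kos_diff l.
Proof.
elim: l u => [|psi l IH] /= u; first by move=> _ _ _ ->; exists 0; rewrite mul0mx.
move=> /commuting_cons[hc hp] [hr hpsi].
rewrite -{1}[u]hsubmxK; set u0 := lsubmx u; set u1 := rsubmx u.
rewrite mul_row_block => /(congr1 (fun w => (lsubmx w, rsubmx w))).
rewrite row_mxKl row_mxKr !raddf0 add0r mulmxN => -[h0 h1] [w hw].
have {}h1 : u1 *m kos_diff l = 0 by apply/eqP; rewrite -oppr_eq0 h1.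
have [v1 hv1] : exists v, u1 = v *m kos_diff l.
  apply: IH => //; apply: hpsi; rewrite -kos_proj_diag.
  have -> : u1 *m kos_diag l psi = - (u0 *m kos_diff l).
    by apply/eqP; rewrite -addr_eq0 addrC h0.
  by rewrite kos_projN; apply/kos_imN/kos_proj_diff.
(* [t] corrects the choice of [v1] by a cycle in homological degree 0. *)
pose t := v1 - kos_incl l (w + kos_proj v1).
have ht : u1 = t *m kos_diff l by rewrite mulmxBl kos_incl_diff subr0.
have [v0 hv0] : exists v, u0 + t *m kos_diag l psi = v *m kos_diff l.
  apply: IH => //.
    by rewrite mulmxDl -mulmxA kos_diag_comm // mulmxA -ht h0.
  rewrite kos_projD kos_proj_diag kos_projD kos_projN kos_inclK.
  by rewrite opprD addrC addrA addrAC [_ - w]addrC addrA addrK mulNmx addrC.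
exists (row_mx v0 (- t)).
rewrite mul_row_block mulmx0 add0r mulmxN !mulNmx opprK -ht.
by rewrite -hv0 addrK hsubmxK.
Qed.

End Koszul.

(** * The Koszul complex as a graded resolution *)

Section KoszulResolution.
Variables (k : fieldType) (A : comAlgType k) (gr : nat -> A -> Prop).
Variables (N : nat) (t : 'I_N -> A) (n : nat).
Local Notation S := {mpoly k[N]}.
Variables (dg0 : 'I_n -> nat) (aug0 : 'I_n -> A).
Implicit Types (l : seq 'M[S]_n).

Definition kos_deg l (x : 'I_(kos_size l)) := (dg0 (kos_base x) + kos_hd x)%N.
Definition kos_aug l (x : 'I_(kos_size l)) :=
  if kos_hd x == 0%N then aug0 (kos_base x) else 0.

Lemma kos_sum_aug l (u : 'rV[S]_(kos_size l)) :
  \sum_x gen_eval t (u 0 x) * kos_aug x =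
  \sum_c gen_eval t (kos_proj u 0 c) * aug0 c.
Proof.
elim: l u => [|psi l IH] /= u; first by apply: eq_bigr => c _.
rewrite big_split_ord /= [X in _ + X]big1 ?addr0 => [|x _]; last first.
  by rewrite /kos_aug /= (unsplitK (inr x)) mulr0.
rewrite -IH; apply: eq_bigr => x _.
by rewrite /kos_aug /= (unsplitK (inl x)) mxE.
Qed.

Lemma kos_diag_hd l (psi : 'M[S]_n) x y : kos_diag l psi x y != 0 -> kos_hd x = kos_hd y.
Proof.
elim: l x y => [|phi l IH] //= x y.
rewrite -[x]splitK -[y]splitK !unsplitK.
case: (split x) (split y) => x' [] y' /=.
- by rewrite block_mxEul => /IH.
- by rewrite block_mxEur mxE eqxx.
- by rewrite block_mxEdl mxE eqxx.
- by rewrite block_mxEdr => /IH ->.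
Qed.

Lemma kos_diff_hd l x y : kos_diff l x y != 0 -> kos_hd x = (kos_hd y).+1.
Proof.
elim: l x y => [|phi l IH] /= x y; first by rewrite mxE eqxx.
rewrite -[x]splitK -[y]splitK !unsplitK.
case: (split x) (split y) => x' [] y' /=.
- by rewrite block_mxEul => /IH.
- by rewrite block_mxEur mxE eqxx.
- by rewrite block_mxEdl => /kos_diag_hd ->.
- by rewrite block_mxEdr mxE oppr_eq0 => /IH ->.
Qed.

Lemma kos_diag_deg l (psi : 'M[S]_n) :
  (forall c c', gdeg (psi c c') (dg0 c).+1 (dg0 c')) ->
  forall x y, gdeg (kos_diag l psi x y) (kos_deg x).+1 (kos_deg y).
Proof.
move=> h; elim: l => [|phi l IH] x y.
  by rewrite /kos_deg /= !addn0; apply: h.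
rewrite /kos_deg /= -[x]splitK -[y]splitK !unsplitK.
case: (split x) (split y) => x' [] y' /=.
- by rewrite block_mxEul; apply: IH.
- by rewrite block_mxEur mxE; apply: gdeg0.
- by rewrite block_mxEdl mxE; apply: gdeg0.
- rewrite block_mxEdr => m /IH; rewrite /kos_deg; lia.
Qed.

Lemma kos_diff_deg l :
  {in l, forall psi : 'M_n, forall c c', gdeg (psi c c') (dg0 c).+1 (dg0 c')} ->
  forall x y, gdeg (kos_diff l x y) (kos_deg x) (kos_deg y).
Proof.
elim: l => [|phi l IH] h x y; first by rewrite mxE; apply: gdeg0.
have {}IH : forall x y, gdeg (kos_diff l x y) (kos_deg x) (kos_deg y).
  by apply: IH => psi hpsi; apply: h; rewrite inE hpsi orbT.
rewrite /kos_deg /= -[x]splitK -[y]splitK !unsplitK.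
case: (split x) (split y) => x' [] y' /=.
- by rewrite block_mxEul; apply: IH.
- by rewrite block_mxEur mxE; apply: gdeg0.
- by rewrite block_mxEdl addnS; apply: kos_diag_deg; apply: h; rewrite mem_head.
- rewrite block_mxEdr mxE; apply: gdegN => m /IH; rewrite /kos_deg; lia.
Qed.

Lemma kos_hd_le l (x : 'I_(kos_size l)) : (kos_hd x <= size l)%N.
Proof.
elim: l x => [|phi l IH] //= x; case: (split x) => y; last exact: IH.
by apply: leq_trans (IH y) _.
Qed.

Lemma kos_top l c : exists x : 'I_(kos_size l), kos_hd x = size l /\ kos_base x = c.
Proof.
elim: l => [|phi l [x [hx bx]]] /=; first by exists c.
by exists (unsplit (inr x)); rewrite unsplitK hx bx.
Qed.

Lemma kos_resolves l : commuting l -> kos_regular l ->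
  (forall w, kos_im l w <-> \sum_c gen_eval t (w 0 c) * aug0 c = 0) ->
  (forall a : A, exists w : 'rV[S]_n, a = \sum_c gen_eval t (w 0 c) * aug0 c) ->
  resolves (eval_rmorph t) (@kos_hd S n l) (@kos_aug l) setT
    (fun x y => kos_diff l x y).
Proof.
move=> hc hr him hs.
have sumT (V : nmodType) (F : 'I_(kos_size l) -> V) :
    \sum_(x in [set: 'I_(kos_size l)]) F x = \sum_x F x.
  by apply: eq_bigl => x; rewrite inE.
have sumM (u : 'I_(kos_size l) -> S) y :
    \sum_x u x * kos_diff l x y = ((\row_x u x) *m kos_diff l) 0 y.
  by rewrite mxE; apply: eq_bigr => x _; rewrite mxE.
have sumA (u : 'I_(kos_size l) -> S) :
    \sum_x gen_eval t (u x) * kos_aug x =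
    \sum_c gen_eval t (kos_proj (\row_x u x) 0 c) * aug0 c.
  by rewrite -kos_sum_aug; apply: eq_bigr => x _; rewrite mxE.
split.
- exact: kos_diff_hd.
- move=> x z _ _; rewrite sumT.
  by have := congr1 (fun M : 'M_(_) => M x z) (kos_diff2 hc); rewrite !mxE.
- move=> x _; rewrite sumT [LHS](sumA (fun y => kos_diff l x y)).
  apply/him; have -> : \row_y kos_diff l x y = delta_mx 0 x *m kos_diff l.
    by rewrite -rowE; apply/rowP => y; rewrite !mxE.
  exact: kos_proj_diff.
- move=> u hu; rewrite sumT [X in X = 0 -> _]sumA => /him hk.
  have [|v hv] := kos_exact hc hr _ hk.
    apply/rowP => y; rewrite -sumM mxE -[RHS](hu y) ?inE //.
    by rewrite sumT.
  exists (fun x => v 0 x) => x _; rewrite sumT.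
  move/rowP: hv => /(_ x); rewrite !mxE => ->; apply: eq_bigr => z _ //.
- move=> a; have [w ->] := hs a; exists (fun x => kos_incl l w 0 x).
  rewrite sumT [RHS]sumA; have -> : \row_x kos_incl l w 0 x = kos_incl l w.
    by apply/rowP => x; rewrite mxE.
  by rewrite kos_inclK.
Qed.

Lemma koszul_regularity l r c0 : commuting l -> kos_regular l ->
  {in l, forall psi : 'M_n, forall c c', gdeg (psi c c') (dg0 c).+1 (dg0 c')} ->
  (forall w, kos_im l w <-> \sum_c gen_eval t (w 0 c) * aug0 c = 0) ->
  (forall a : A, exists w : 'rV[S]_n, a = \sum_c gen_eval t (w 0 c) * aug0 c) ->
  (forall c, dg0 c <= r)%N -> dg0 c0 = r ->
  (forall c, gr (dg0 c) (aug0 c)) ->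
  regularity gr t r%:Z.
Proof.
move=> hc hr hl him hs hle h0 hgr.
have [p [hp bp]] := kos_top l c0.
apply: (@resolution_regularity _ _ gr _ t _ (@kos_hd S n l) (@kos_deg l)
  (@kos_aug l) _ setT (fun x y => kos_diff l x y) (size l) r p) => //.
- by move=> x; rewrite /kos_aug => /negPf ->.
- exact: kos_resolves.
- exact: kos_diff_deg.
- by move=> x _; apply: kos_hd_le.
- by move=> x _; rewrite leq_add2r.
- by rewrite /kos_deg hp bp h0.
- by move=> x _ hx; rewrite /kos_deg /kos_aug hx addn0 eqxx.
Qed.

End KoszulResolution.

(** * The semigroup and its Apery set *)

Section Semigroup.
Variables (a b d : nat).
Hypotheses (lt_ab : (a < b)%N) (le_bd : (b <= d)%N).
Local Open Scope nat_scope.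

Let b_gt0 : 0 < b := leq_ltn_trans (leq0n a) lt_ab.
Let d_gt0 : 0 < d := leq_trans b_gt0 le_bd.

(** The ceiling of [x / b]. *)
Definition cdiv x := (x + b.-1) %/ b.

Lemma cdiv_le x l : (cdiv x <= l) = (x <= l * b).
Proof. by rewrite -ltnS ltn_divLR // mulSn; lia. Qed.

(* [x] is a sum of integers of the interval [a, b], the least possible number of
   summands being [cdiv x]. *)
Definition in_sg x := cdiv x * a <= x.

Lemma in_sgW l x : l * a <= x -> x <= l * b -> in_sg x.
Proof.
move=> h1 h2; apply: leq_trans h1; rewrite leq_mul2r; apply/orP; right.
by rewrite cdiv_le.
Qed.

Lemma apery_ex c : exists x, in_sg x && (x == c %[mod d]).
Proof.
(* As [a < b], sums of [d] summands cover all integers from [d * a] to [d * a + d], hence every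
   residue class. *)
exists (d * a + c %% d); rewrite mulnC modnMDl modn_mod eqxx andbT.
have := ltn_pmod c d_gt0; move: (c %% d) => e he.
apply: (in_sgW (l := d)); first by rewrite mulnC leq_addr.
apply: (@leq_trans (d * a + d)); first by rewrite mulnC leq_add2l ltnW.
by rewrite -mulnSr leq_mul2l lt_ab orbT.
Qed.

Definition apery c := ex_minn (apery_ex c).
Definition aht c := cdiv (apery c).

Lemma apery_sg c : in_sg (apery c).
Proof. by rewrite /apery; case: ex_minnP => x /andP[]. Qed.

Lemma apery_mod c : apery c = c %[mod d].
Proof. by rewrite /apery; case: ex_minnP => x /andP[_ /eqP]. Qed.

Lemma apery_min c x : in_sg x -> x = c %[mod d] -> apery c <= x.
Proof.
rewrite /apery; case: ex_minnP => y _ h hx hc; apply: h.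
by rewrite hx /= hc.
Qed.

Lemma eq_apery c c' : c = c' %[mod d] -> apery c = apery c'.
Proof.
move=> h; apply/eqP; rewrite eqn_leq.
rewrite (apery_min (apery_sg c')) ?(apery_min (apery_sg c)) //.
  by rewrite apery_mod h.
by rewrite apery_mod h.
Qed.

Lemma eq_aht c c' : c = c' %[mod d] -> aht c = aht c'.
Proof. by rewrite /aht => /eq_apery ->. Qed.

Lemma apery_ge c : aht c * a <= apery c.
Proof. exact: apery_sg. Qed.

Lemma apery_le c : apery c <= aht c * b.
Proof. by rewrite -cdiv_le. Qed.

Lemma apery_led c : apery c <= d * aht c.
Proof. by rewrite mulnC (leq_trans (apery_le c)) // leq_mul2l le_bd orbT. Qed.

Lemma aht_apery x l : x <= l * b -> in_sg x -> aht x <= l.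
Proof.
move=> h1 h2; rewrite cdiv_le; apply: leq_trans h1; exact: apery_min.
Qed.

Lemma apery0 : apery 0 = 0.
Proof.
apply/eqP; rewrite -leqn0; apply: apery_min => //.
by apply: (in_sgW (l := 0)).
Qed.

Lemma aht0 : aht 0 = 0.
Proof. by rewrite /aht apery0; apply/eqP; rewrite -leqn0 cdiv_le. Qed.

(* The key to the Cohen-Macaulay property: as [b <= d], a representation of an
   integer involving [i0] copies of [d] is never shorter than the one built on the
   least element of the residue class. *)
Lemma apery_decomp p i0 x l n : p = x + i0 * d -> l * a <= x -> x <= l * b ->
  i0 + l <= n -> exists i j, p = apery p + i * d /\ n = aht p + i + j.
Proof.
move=> hp hx1 hx2 hn.
have hm : apery p <= x.
  apply: apery_min; first exact: in_sgW hx1 hx2.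
  by rewrite hp addnC modnMDl.
have /dvdnP[f hf] : d %| x - apery p.
  by rewrite -eqn_mod_dvd // apery_mod hp addnC modnMDl.
have hx : x = apery p + f * d by lia.
have fl : f <= l.
  rewrite -(leq_pmul2r d_gt0); apply: (@leq_trans (l * b)); last by rewrite leq_mul2l le_bd orbT.
  lia.
have h1 : aht p <= l - f.
  rewrite cdiv_le mulnBl; have : f * b <= f * d by rewrite leq_mul2l le_bd orbT.
  lia.
exists (f + i0), (n - aht p - f - i0); split; last lia.
by rewrite mulnDl addnA -hx.
Qed.

End Semigroup.

Section BivariateMonomials.

Definition mn (p q : nat) : 'X_{1..2} := (U_(ord0) *+ p + U_(ord_max) *+ q)%MM.

Lemma mnE0 p q : mn p q ord0 = p.
Proof. by rewrite mnmDE !mulmnE !mnm1E /=; lia. Qed.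

Lemma mnE1 p q : mn p q ord_max = q.
Proof. by rewrite mnmDE !mulmnE !mnm1E /=; lia. Qed.

Lemma eq_mnm2 (m m' : 'X_{1..2}) : m ord0 = m' ord0 -> m ord_max = m' ord_max -> m = m'.
Proof.
move=> h0 h1; apply/mnmP => i; case: (unliftP ord0 i) => [j ->|-> //].
by rewrite (_ : lift _ _ = ord_max) //; apply/val_inj; case: j => [[]].
Qed.

Lemma mnK (m : 'X_{1..2}) : mn (m ord0) (m ord_max) = m.
Proof. by apply: eq_mnm2; rewrite ?mnE0 ?mnE1. Qed.

Lemma mnD p q p' q' : (mn p q + mn p' q')%MM = mn (p + p') (q + q').
Proof. by apply: eq_mnm2; rewrite mnmDE ?mnE0 ?mnE1. Qed.

Lemma mnMn p q n : (mn p q *+ n)%MM = mn (p * n) (q * n).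
Proof. by apply: eq_mnm2; rewrite mulmnE ?mnE0 ?mnE1. Qed.

Lemma mdeg_mn p q : mdeg (mn p q) = (p + q)%N.
Proof. by rewrite mdegD !mdegMn !mdeg1 !mul1n. Qed.

Lemma mon_mn (k : fieldType) p q : xvar k ^+ p * yvar k ^+ q = 'X_[mn p q].
Proof. by rewrite /mn mpolyXD -!mpolyXn. Qed.

End BivariateMonomials.

(** * A monomial basis of R over k[x^d, y^d] *)

Section Monomials.
Variables (k : fieldType) (a b d : nat).
Hypotheses (lt_ab : (a < b)%N) (le_bd : (b <= d)%N).
Local Notation R := (monR k a b d).
Local Notation P2 := {mpoly k[2]}.
Local Notation ap := (apery lt_ab le_bd).
Local Notation ht := (aht lt_ab le_bd).

Let d_gt0 : (0 < d)%N := leq_trans (leq_ltn_trans (leq0n a) lt_ab) le_bd.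

(* The exponent of (x^d)^i (y^d)^j b_c. *)
Definition apm c i j := mn (ap c + i * d) (d * (ht c + j) - ap c).

Lemma apm_le c j : (ap c <= d * (ht c + j))%N.
Proof. by rewrite mulnDr (leq_trans (apery_led lt_ab le_bd c)) ?leq_addr. Qed.

Lemma mdeg_apm c i j : mdeg (apm c i j) = (d * (ht c + i + j))%N.
Proof. rewrite mdeg_mn; have := apm_le c j; rewrite !mulnDr; lia. Qed.

(** The exponent of x determines c modulo d, then i; the total degree determines j. Linear
    independence over k[x^d, y^d] rests on this. *)
Lemma apm_inj (c c' : 'I_d) i j i' j' :
  apm c i j = apm c' i' j' -> [/\ c = c', i = i' & j = j'].
Proof.
move=> h; have h0 := congr1 (fun m : 'X_{1..2} => m ord0) h.
have h1 := congr1 mdeg h; move: h0; rewrite /= !mnE0 => h0.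
have cc : c = c'.
  apply/val_inj => /=; rewrite -(modn_small (ltn_ord c)) -(modn_small (ltn_ord c')).
  rewrite -(apery_mod lt_ab le_bd c) -(apery_mod lt_ab le_bd c').
  by have := congr1 (modn^~ d) h0; rewrite /= !(addnC (ap _)) !modnMDl.
subst c'; move/addnI: h0 => /eqP; rewrite eqn_pmul2r // => /eqP ii; subst i'.
move: h1; rewrite !mdeg_apm => /eqP; rewrite eqn_pmul2l // eqn_add2l => /eqP jj.
by [].
Qed.

Definition inH (m : 'X_{1..2}) := exists (c : 'I_d) i j, m = apm c i j.

Lemma apm_decomp p i0 x l n : p = (x + i0 * d)%N -> (l * a <= x)%N -> (x <= l * b)%N ->
  (i0 + l <= n)%N -> inH (mn p (d * n - p)).
Proof.
move=> h1 h2 h3 h4; have [i [j [hp hn]]] := apery_decomp lt_ab le_bd h1 h2 h3 h4.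
pose c : 'I_d := Ordinal (ltn_pmod p d_gt0).
have e : c = p %[mod d] by rewrite /= modn_mod.
exists c, i, j; rewrite /apm (eq_apery _ _ e) (eq_aht _ _ e) -hp hn; congr mn.
rewrite !mulnDr; lia.
Qed.

(** Two representations add up to one with [ht c + ht c'] summands, which [apm_decomp] brings back
    to normal form; so the basis monomials span a ring. *)
Lemma inH_add (m m' : 'X_{1..2}) : inH m -> inH m' -> inH (m + m')%MM.
Proof.
move=> [c [i [j ->]]] [c' [i' [j' ->]]].
have [] := @apm_decomp (ap c + i * d + (ap c' + i' * d)) (i + i') (ap c + ap c')
   (ht c + ht c') (ht c + i + j + (ht c' + i' + j')).
- by rewrite mulnDl; lia.
- by rewrite mulnDl leq_add ?apery_ge.
- by rewrite mulnDl leq_add ?apery_le.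
- lia.
move=> e [i2 [j2 h]]; exists e, i2, j2; rewrite -h /apm mnD; congr mn.
have := apm_le c j; have := apm_le c' j'; rewrite !mulnDr; lia.
Qed.

Lemma inH_gen x : x \in 0%N :: d :: index_iota a b.+1 -> inH (mn x (d - x)).
Proof.
rewrite !inE mem_index_iota; have -> : (d - x = d * 1 - x)%N by rewrite muln1.
case/or3P=> [/eqP ->|/eqP ->|/andP[h1 h2]].
- by apply: (@apm_decomp _ 0 0 0).
- by apply: (@apm_decomp _ 1 0 0); rewrite ?mul1n.
- by apply: (@apm_decomp _ 0 x 1); rewrite ?mul1n ?addn0 // -ltnS.
Qed.

Definition suppH (p : P2) := {in msupp p, forall m, inH m}.

Lemma val_suppH (p : R) : suppH (subalg_val p).
Proof.
have /asboolP := subalg_valP p; apply; last first.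
  move=> q /mapP[x hx ->] m; rewrite mon_mn msuppX inE => /eqP ->.
  exact: inH_gen.
split=> [m|c p' q' hp hq m|p' q' hp hq m].
- rewrite msupp1 inE => /eqP ->.
  have -> : (0 = mn 0 (d * 0 - 0))%MM by apply: eq_mnm2; rewrite ?mnE0 ?mnE1 ?mnm0E ?muln0.
  exact: (@apm_decomp _ 0 0 0).
- move=> /msuppD_le; rewrite mem_cat => /orP[/msuppZ_le|]; [exact: hp|exact: hq].
- move=> /msuppM_le /allpairsP[[m1 m2] /= [h1 h2 ->]].
  by apply: inH_add; [apply: hp|apply: hq].
Qed.

Lemma subalg_monX X x : X \in subalg_mem (monomials k a b d) ->
  x \in 0%N :: d :: index_iota a b.+1 ->
  'X_[mn x (d - x)] * X \in subalg_mem (monomials k a b d).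
Proof.
move=> hX hx; apply: rpredM => //; apply: mem_subalg; apply/mapP; exists x => //.
by rewrite mon_mn.
Qed.

(* Every monomial of the algebra is a product of generators; [P] records a property
   of the partial products. *)
Lemma apm_ind (P : nat -> 'X_{1..2} -> Prop) : P 0%N 0%MM ->
  (forall n x m, x \in 0%N :: d :: index_iota a b.+1 -> P n m ->
     P n.+1 (mn x (d - x) + m)%MM) ->
  forall c i j, P (ht c + i + j)%N (apm c i j).
Proof.
move=> P0 PS c i j.
have base l x : (l * a <= x)%N -> (x <= l * b)%N -> P l (mn x (d * l - x)).
  elim: l x => [|l IH] x h1 h2.
    have -> : x = 0%N by lia.
    by rewrite muln0; move: P0; congr P; apply: eq_mnm2; rewrite ?mnE0 ?mnE1 mnm0E.
  (* The smallest admissible summand that leaves at most [l * b]; what remains is still at least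
     [l * a]. *)
  pose e := maxn a (x - l * b).
  have eb : (a <= e <= b)%N by rewrite /e; move: h1 h2; rewrite !mulSn; lia.
  have h3 : (l * a <= x - e)%N.
    have hl : (l * a <= l * b)%N by rewrite leq_mul2l ltnW ?orbT.
    by rewrite /e; move: h1 h2; rewrite !mulSn; lia.
  have h4 : (x - e <= l * b)%N by rewrite /e; lia.
  have ex : (e <= x)%N by rewrite /e; move: h1; rewrite mulSn; lia.
  have led : (e <= d)%N by apply: leq_trans le_bd; case/andP: eb.
  have ld : (l * b <= d * l)%N by rewrite mulnC leq_mul2r le_bd orbT.
  have := PS l e _ _ (IH _ h3 h4); rewrite mnD !inE mem_index_iota ltnS eb !orbT => /(_ isT).
  by congr (P _ (mn _ _)); rewrite ?mulnSr; lia.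
have hi i' : P (ht c + i')%N (apm c i' 0).
  elim: i' => [|i' IH].
    by rewrite /apm !addn0; apply: base; [apply: apery_ge|apply: apery_le].
  have := PS _ d _ _ IH; rewrite !inE eqxx orbT => /(_ isT).
  by rewrite subnn /apm mnD addnS mulSn; congr (P _ (mn _ _)); lia.
elim: j => [|j IH]; first by rewrite addn0.
have := PS _ 0%N _ _ IH; rewrite !inE eqxx => /(_ isT).
rewrite subn0 /apm mnD !addnS mulnSr; congr (P _ (mn _ _)).
by have := apm_le c j; lia.
Qed.

Lemma apm_mem c i j : 'X_[apm c i j] \in subalg_mem (monomials k a b d).
Proof.
apply: (apm_ind (P := fun _ m => is_true ('X_[m] \in subalg_mem (monomials k a b d)))).
  by rewrite mpolyX0 rpred1.
by move=> _ x m hx hm; rewrite mpolyXD; apply: subalg_monX.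
Qed.

(* The junk value 0 is taken when the monomial is not in R. *)
Definition Rmon (m : 'X_{1..2}) : R := insubd (0 : R) ('X_[m] : P2).

Lemma Rmon_val m : inH m -> subalg_val (Rmon m) = 'X_[m].
Proof. by move=> [c [i [j ->]]]; rewrite [LHS]insubdK //; apply: apm_mem. Qed.

Lemma apmH (c : 'I_d) i j : inH (apm c i j).
Proof. by exists c, i, j. Qed.

Definition valr : {rmorphism R -> P2} :=
  ((val : subalg (monomials k a b d) -> P2) :
     {rmorphism subalg (monomials k a b d) -> P2}).

Lemma valrZ c p : valr (c *: p) = c *: valr p.
Proof. by []. Qed.

Lemma valr_inj : injective valr.
Proof. exact: val_inj. Qed.

Lemma valr_supp p : suppH (valr p).
Proof. exact: val_suppH. Qed.

Lemma Rmon_valr m : inH m -> valr (Rmon m) = 'X_[m].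
Proof. exact: Rmon_val. Qed.

Lemma monR_expand (p : R) : p = \sum_(m <- msupp (valr p)) (valr p)@_m *: Rmon m.
Proof.
apply: valr_inj; rewrite rmorph_sum [LHS]mpolyE; apply: eq_big_seq => m hm.
by rewrite valrZ Rmon_valr //; apply: valr_supp hm.
Qed.

Lemma RmonM m m' : inH m -> inH m' -> Rmon (m + m')%MM = Rmon m * Rmon m'.
Proof.
move=> h h'; apply: valr_inj; rewrite rmorphM !Rmon_valr ?mpolyXD //.
exact: inH_add.
Qed.

Definition yd : R := Rmon (mn 0 d).
Definition xd : R := Rmon (mn d 0).
Definition bas (c : nat) : R := Rmon (apm c 0 0).

Lemma mn0H n : inH (mn 0 (d * n)).
Proof. by have := @apm_decomp 0 0 0 0 n; rewrite subn0; apply. Qed.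

Lemma mndH n : inH (mn (d * n) 0).
Proof.
have := @apm_decomp (d * n) n 0 0 n; rewrite subnn; apply=> //; first by rewrite mulnC.
by rewrite addn0.
Qed.

Lemma valr_yd n : valr (yd ^+ n) = 'X_[mn 0 (d * n)].
Proof.
rewrite rmorphXn Rmon_valr; last by have := mn0H 1; rewrite muln1.
by rewrite mpolyXn mnMn.
Qed.

Lemma valr_xd n : valr (xd ^+ n) = 'X_[mn (d * n) 0].
Proof.
rewrite rmorphXn Rmon_valr; last by have := mndH 1; rewrite muln1.
by rewrite mpolyXn mnMn.
Qed.

Lemma Rmon_apm (c : 'I_d) i j : Rmon (apm c i j) = xd ^+ i * yd ^+ j * bas c.
Proof.
apply: valr_inj; rewrite !rmorphM valr_xd valr_yd !Rmon_valr; try exact: apmH.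
rewrite -!mpolyXD /apm !mnD; congr 'X_[mn _ _]; first by lia.
by have := apm_le c 0; rewrite !mulnDr; lia.
Qed.

Lemma monR_ind (P : R -> Prop) : (forall x y, P x -> P y -> P (x + y)) ->
  (forall (c : k) x, P x -> P (c *: x)) -> (forall x, P x -> P (yd * x)) ->
  (forall x, P x -> P (xd * x)) -> (forall c : 'I_d, P (bas c)) -> forall x, P x.
Proof.
move=> hD hZ hy hx hb p; rewrite (monR_expand p) big_seq.
apply: big_ind => [||m hm]; [|exact: hD|apply: hZ].
  by rewrite -(scale0r (bas (Ordinal d_gt0))); apply: hZ.
have [c [i [j ->]]] := valr_supp hm; rewrite Rmon_apm -mulrA.
elim: i => [|i IH]; last by rewrite exprS -mulrA; apply: hx.
rewrite expr0 mul1r; elim: j {hm} => [|j IH]; last by rewrite exprS -mulrA; apply: hy.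
by rewrite expr0 mul1r.
Qed.

Lemma monR_domain (x y : R) : x * y = 0 -> x = 0 \/ y = 0.
Proof.
move=> /(congr1 valr); rewrite rmorphM rmorph0 => /eqP; rewrite mulf_eq0.
by case/orP=> /eqP h; [left|right]; apply: valr_inj; rewrite h rmorph0.
Qed.

Lemma horner_alg_yd (f : {poly k}) : horner_alg yd f = \sum_(j < size f) f`_j *: yd ^+ j.
Proof.
rewrite -[LHS]/((map_poly (in_alg R) f).[yd]).
rewrite (horner_coef_wide _ (size_poly _ _)); apply: eq_bigr => j _.
by rewrite coef_map /= mulr_algl.
Qed.

Lemma ev2_bas (p : {poly {poly k}}) (c : 'I_d) : ev2 yd xd p * bas c =
  \sum_(i < size p) \sum_(j < size p`_i) (p`_i)`_j *: Rmon (apm c i j).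
Proof.
have -> : ev2 yd xd p = \sum_(i < size p) horner_alg yd p`_i * xd ^+ i.
  by rewrite [LHS](horner_coef_wide _ (size_poly _ _)); apply: eq_bigr => i _; rewrite coef_map.
rewrite mulr_suml; apply: eq_bigr => i _; rewrite horner_alg_yd !mulr_suml.
by apply: eq_bigr => j _; rewrite Rmon_apm -!scalerAl; congr (_ *: _); ring.
Qed.

Lemma ev2_bas_coef p (c c' : 'I_d) i j :
  (valr (ev2 yd xd p * bas c))@_(apm c' i j) = if c == c' then (p`_i)`_j else 0.
Proof.
have -> : (valr (ev2 yd xd p * bas c))@_(apm c' i j) =
    \sum_(l < size p) \sum_(m < size p`_l)
      (valr ((p`_l)`_m *: Rmon (apm c l m)))@_(apm c' i j).
  rewrite ev2_bas rmorph_sum raddf_sum; apply: eq_bigr => l _.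
  by rewrite rmorph_sum raddf_sum.
have E (l m : nat) : (valr ((p`_l)`_m *: Rmon (apm c l m)))@_(apm c' i j) =
    if [&& c == c', l == i & m == j] then (p`_l)`_m else 0.
  rewrite valrZ mcoeffZ Rmon_valr; last exact: apmH.
  rewrite mcoeffX; case: eqP => [/apm_inj[-> -> ->]|h].
    by rewrite !eqxx mulr1.
  case: ifP => [/and3P[/eqP hc /eqP hl /eqP hm]|]; last by rewrite mulr0.
  by case: h; rewrite hc hl hm.
under eq_bigr => l _ do under eq_bigr => m _ do rewrite E.
case: eqP => [cc|_]; last first.
  by rewrite big1 // => l _; rewrite big1.
case: (ltnP i (size p)) => [hi|hi]; last first.
  have -> : p`_i = 0 by apply: nth_default.
  rewrite coef0 big1 // => l _; rewrite big1 // => m _.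
  by case: eqP => //= hl; move: (ltn_ord l); rewrite ltnNge {1}hl hi.
rewrite (bigD1 (Ordinal hi)) //= [X in _ + X]big1 ?addr0 => [|l hl]; last first.
  by rewrite big1 // => m _; move: hl; rewrite -val_eqE /= => /negPf ->.
rewrite eqxx; case: (ltnP j (size p`_i)) => [hj|hj]; last first.
  rewrite [in RHS]nth_default // big1 // => m _.
  by case: eqP => //= hm; move: (ltn_ord m); rewrite ltnNge {1}hm hj.
rewrite (bigD1 (Ordinal hj)) //= eqxx big1 ?addr0 // => m.
by rewrite -val_eqE /= => /negPf ->.
Qed.

Lemma monR_free (p : 'I_d -> {poly {poly k}}) :
  \sum_c ev2 yd xd (p c) * bas c = 0 -> forall c, p c = 0.
Proof.
move=> h c; apply/polyP => i; apply/polyP => j; rewrite !coef0.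
have : \sum_c' (valr (ev2 yd xd (p c') * bas c'))@_(apm c i j) = 0.
  have := congr1 (fun x => (valr x)@_(apm c i j)) h.
  by rewrite rmorph_sum raddf_sum rmorph0 mcoeff0.
under eq_bigr do rewrite ev2_bas_coef.
by rewrite -big_mkcond big_pred1_eq.
Qed.

End Monomials.

(** * Cohen-Macaulayness *)

Section Counting.

Lemma coef_sumX (B : nzRingType) n (q : 'I_n -> B) (i : 'I_n) :
  (\sum_j (q j)%:P * 'X^j)`_i = q i.
Proof.
rewrite coef_sum (bigD1 i) //= coefCM coefXn eqxx mulr1 big1 ?addr0 // => j.
by rewrite -val_eqE eq_sym coefCM coefXn /= => /negPf ->; rewrite mulr0.
Qed.

Lemma horner_sumX (B : nzRingType) (A : comNzRingType) (phi : {rmorphism B -> A})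
    n (q : 'I_n -> B) (x : A) :
  (map_poly phi (\sum_j (q j)%:P * 'X^j)).[x] = \sum_j phi (q j) * x ^+ j.
Proof.
rewrite rmorph_sum /= horner_sum; apply: eq_bigr => j _.
by rewrite rmorphM /= map_polyC map_polyXn /= hornerM hornerC hornerXn.
Qed.

Lemma alg_dep_relation (k : fieldType) (A : comAlgType k) (x0 x1 x2 : A) D
    (c : 'I_D -> 'I_D -> 'I_D -> k) i0 j0 l0 : c i0 j0 l0 != 0 ->
  \sum_i \sum_j \sum_l c i j l *: (x0 ^+ i * x1 ^+ j * x2 ^+ l) = 0 ->
  alg_dep x0 x1 x2.
Proof.
move=> nz h.
pose q2 i j : {poly k} := \sum_l (c i j l)%:P * 'X^l.
pose q1 i : {poly {poly k}} := \sum_j (q2 i j)%:P * 'X^j.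
exists (\sum_i (q1 i)%:P * 'X^i); split.
  apply: contraNneq nz => /(congr1 (fun Q : {poly {poly {poly k}}} => Q`_i0`_j0`_l0)).
  by rewrite coef_sumX coef_sumX coef_sumX !coef0 => ->.
rewrite horner_sumX -[RHS]h; apply: eq_bigr => i _.
rewrite [X in X * _](horner_sumX (horner_alg x2)) mulr_suml; apply: eq_bigr => j _.
rewrite [X in X * _ * _](horner_sumX (in_alg A)) !mulr_suml; apply: eq_bigr => l _.
by rewrite /= mulr_algl -!scalerAl; congr (_ *: _); ring.
Qed.

Lemma exists_left_kernel (k : fieldType) (I J : finType) (F : I -> J -> k) :
  (#|J| < #|I|)%N -> exists z : I -> k, (exists i, z i != 0) /\
    forall j, \sum_i z i * F i j = 0.
Proof.
move=> lt; pose M : 'M[k]_(#|I|, #|J|) := \matrix_(i, j) F (enum_val i) (enum_val j).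
have : kermx M != 0.
  rewrite kermx_eq0 /row_free; apply: contraTneq lt => <-.
  by rewrite -leqNgt rank_leq_col.
case/rowV0Pn => z /sub_kermxP hz nz.
exists (fun i => z 0 (enum_rank i)); split.
  have /rV0Pn[i hi] := nz; exists (enum_val i); by rewrite enum_valK.
move=> j; rewrite (reindex _ (onW_bij _ (@enum_val_bij I))) /=.
have := congr1 (fun N : 'rV_(_) => N 0 (enum_rank j)) hz; rewrite !mxE => h.
rewrite -[RHS]h; apply: eq_bigr => i _.
by rewrite !mxE enum_valK enum_rankK.
Qed.

Lemma mdeg_expr_le (k : fieldType) (p : {mpoly k[2]}) e n :
  {in msupp p, forall m, mdeg m <= e}%N -> {in msupp (p ^+ n), forall m, mdeg m <= n * e}%N.
Proof.
move=> h; elim: n => [|n IH] m.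
  by rewrite expr0 msupp1 inE => /eqP ->; rewrite mdeg0.
rewrite exprS => /msuppM_le /allpairsP[[m1 m2] /= [h1 h2 ->]].
by rewrite mdegD mulSn leq_add ?h ?IH.
Qed.

(* There are more than D^3 monomials in three elements of degree at most e, all in a
   space of dimension at most (3De + 1)^2. *)
Lemma alg_dep_mpoly2 (k : fieldType) (x0 x1 x2 : {mpoly k[2]}) :
  exists D (c : 'I_D -> 'I_D -> 'I_D -> k) i0 j0 l0, c i0 j0 l0 != 0 /\
    \sum_i \sum_j \sum_l c i j l *: (x0 ^+ i * x1 ^+ j * x2 ^+ l) = 0.
Proof.
pose e := (msize x0 + msize x1 + msize x2).+1.
have he x : (msize x <= e)%N -> {in msupp x, forall m, mdeg m <= e}%N.
  by move=> hx m /msize_mdeg_lt /ltnW hm; apply: leq_trans hm hx.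
have h0 : {in msupp x0, forall m, mdeg m <= e}%N by apply: he; rewrite /e; lia.
have h1 : {in msupp x1, forall m, mdeg m <= e}%N by apply: he; rewrite /e; lia.
have h2 : {in msupp x2, forall m, mdeg m <= e}%N by apply: he; rewrite /e; lia.
(* [B] exceeds the degree of every product considered, and B^2 <= (4De)^2 = D^2 (16 e^2) < D^3. *)
pose D := (16 * e * e).+1; pose B := (3 * D * e).+1.
have lt_card : (#|{: 'I_B * 'I_B}| < #|{: 'I_D * 'I_D * 'I_D}|)%N.
  rewrite !card_prod !card_ord /B.
  have D1 : (0 < D)%N by [].
  have e1 : (0 < e)%N by [].
  have le1 : ((3 * D * e).+1 <= 4 * D * e)%N by nia.
  apply: (@leq_ltn_trans ((4 * D * e) * (4 * D * e))%N); first exact: leq_mul.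
  have -> : (4 * D * e * (4 * D * e) = D * D * (16 * e * e))%N by ring.
  by rewrite ltn_pmul2l ?muln_gt0 ?D1 // /D ltnS.
pose X (t : 'I_D * 'I_D * 'I_D) := x0 ^+ t.1.1 * x1 ^+ t.1.2 * x2 ^+ t.2.
have [z [[t zt] hz]] := exists_left_kernel
  (fun (t : 'I_D * 'I_D * 'I_D) (m : 'I_B * 'I_B) => (X t)@_(mn m.1 m.2)) lt_card.
exists D, (fun i j l => z (i, j, l)), t.1.1, t.1.2, t.2; split.
  by case: t zt => -[].
have -> : \sum_i \sum_j \sum_l z (i, j, l) *: (x0 ^+ i * x1 ^+ j * x2 ^+ l) =
    \sum_t z t *: X t.
  rewrite pair_big pair_big /=; apply: eq_bigr => -[[i j] l] _ //.
apply/mpolyP => m; rewrite mcoeff0 raddf_sum /=.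
have [/andP[hm0 hm1]|hm] := boolP ((m ord0 < B) && (m ord_max < B))%N.
  rewrite -[RHS](hz (Ordinal hm0, Ordinal hm1)); apply: eq_bigr => s _.
  by rewrite mcoeffZ /= mnK.
rewrite big1 // => s _; rewrite mcoeffZ; apply/eqP; rewrite mulf_eq0 mcoeff_eq0.
apply/orP; right; apply: contra hm => /msuppM_le /allpairsP[[m1 m2] /= [/msuppM_le]].
move=> /allpairsP[[m3 m4] /= [hm3 hm4 ->]] hm2 em.
have le_m : (mdeg m <= 3 * D * e)%N.
  rewrite em !mdegD; have := mdeg_expr_le h0 hm3; have := mdeg_expr_le h1 hm4.
  have := mdeg_expr_le h2 hm2; have := ltn_ord s.1.1; have := ltn_ord s.1.2; have := ltn_ord s.2.
  move: (mdeg _) (mdeg _) (mdeg _) => n1 n2 n3.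
  move: (nat_of_ord s.2) (nat_of_ord s.1.2) (nat_of_ord s.1.1) => s1 s2 s3; nia.
have := mdeg_mn (m ord0) (m ord_max); rewrite mnK => hd.
by rewrite /B; lia.
Qed.

End Counting.

Section CohenMacaulay.
Variables (k : fieldType) (a b d : nat).
Hypotheses (lt_ab : (a < b)%N) (le_bd : (b <= d)%N).
Local Notation R := (monR k a b d).
Local Notation apm := (apm lt_ab le_bd).
Local Notation inH := (inH lt_ab le_bd).
Local Notation Rmon := (Rmon k a b d).
Local Notation valr := (valr k a b d).
Local Notation yd := (yd k a b d).
Local Notation xd := (xd k a b d).
Local Notation bas := (bas k lt_ab le_bd).

Let d_gt0 : (0 < d)%N := leq_trans (leq_ltn_trans (leq0n a) lt_ab) le_bd.

Lemma monR_alg_dep (x0 x1 x2 : R) : alg_dep x0 x1 x2.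
Proof.
have [D [c [i0 [j0 [l0 [nz h]]]]]] := alg_dep_mpoly2 (valr x0) (valr x1) (valr x2).
apply: (alg_dep_relation nz); apply: valr_inj; rewrite rmorph0 -[RHS]h.
rewrite rmorph_sum; apply: eq_bigr => i _; rewrite rmorph_sum; apply: eq_bigr => j _.
rewrite rmorph_sum; apply: eq_bigr => l _.
by rewrite valrZ !rmorphM !rmorphXn.
Qed.

Lemma monR_subalgebra_ind (B : R -> Prop) : is_subalgebra B ->
  {in 0%N :: d :: index_iota a b.+1, forall x, B (Rmon (mn x (d - x)))} ->
  forall p, B p.
Proof.
move=> [B1 Bl BM] hB p.
have B0 : B 0 by have := Bl (-1) _ _ B1 B1; rewrite scaleN1r addNr.
have Bmon c i j : inH (apm c i j) /\
    B (Rmon (apm c i j)).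
  apply: (apm_ind lt_ab le_bd (P := fun _ m => inH m /\ B (Rmon m))).
    have h0 : inH 0%MM.
      have <- : mn 0 (d * 0) = 0%MM by apply: eq_mnm2; rewrite ?mnE0 ?mnE1 mnm0E ?muln0.
      exact: mn0H.
    split=> //; have -> : Rmon 0 = 1; last exact: B1.
    by apply: valr_inj; rewrite (Rmon_valr _ h0) rmorph1 mpolyX0.
  move=> _ x m hx [hm Bm]; have hmx := inH_gen lt_ab le_bd hx.
  split; first exact: inH_add.
  by rewrite (RmonM k hmx hm); apply: BM => //; apply: hB.
rewrite (monR_expand lt_ab le_bd p) big_seq; apply: big_ind => // [x y Bx By|m hm].
  by rewrite -[x]scale1r; apply: Bl.
have [c [i [j ->]]] := valr_supp lt_ab le_bd hm.
by rewrite -[_ *: _]addr0; apply: Bl => //; case: (Bmon c i j).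
Qed.

Lemma monR_noetherian : noetherian R.
Proof.
apply: (noetherian_finitely_generated
  (X := [seq Rmon (mn x (d - x)) | x <- 0%N :: d :: index_iota a b.+1])).
move=> B hB hX; apply: monR_subalgebra_ind => // x hx; apply: hX.
exact: (map_f (fun x => Rmon (mn x (d - x)))).
Qed.

Lemma monR_cohen_macaulay : cohen_macaulay R.
Proof.
apply: (@cohen_macaulay_of_free k R monR_noetherian (@monR_domain k a b d) monR_alg_dep
  yd xd d (fun c => bas c)) => //.
- exact: monR_ind.
- exact: monR_free.
- move=> /(congr1 valr); have := valr_yd k lt_ab le_bd 1; rewrite expr1 muln1 => ->.
  rewrite rmorph0 => /mpolyP/(_ (mn 0 d)); rewrite mcoeffX eqxx mcoeff0 => /eqP.
  by rewrite oner_eq0.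
- move=> c /(congr1 valr); have := valr_yd k lt_ab le_bd 1; rewrite expr1 muln1 rmorphM => ->.
  rewrite rmorph1 => /(congr1 (mcoeff 0%MM)); rewrite rmorphM rmorph1 /= mcoeffX.
  case: eqP => [h|_]; last by rewrite mulr0 => /eqP; rewrite eq_sym oner_eq0.
  have := congr1 (fun m : 'X_{1..2} => m ord_max) h; rewrite mnE1 mnm0E => d0.
  by have := d_gt0; lia.
Qed.

End CohenMacaulay.

(** * The reduction number *)

Section ReductionNumber.
Variables (k : fieldType) (a b d : nat).
Hypotheses (lt_ab : (a < b)%N) (le_bd : (b <= d)%N).
Local Notation R := (monR k a b d).
Local Notation ap := (apery lt_ab le_bd).
Local Notation ht := (aht lt_ab le_bd).
Local Notation apm := (apm lt_ab le_bd).
Local Notation inH := (inH lt_ab le_bd).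
Local Notation Rmon := (Rmon k a b d).
Local Notation valr := (valr k a b d).
Local Notation yd := (yd k a b d).
Local Notation xd := (xd k a b d).
Local Notation bas := (bas k lt_ab le_bd).

Let d_gt0 : (0 < d)%N := leq_trans (leq_ltn_trans (leq0n a) lt_ab) le_bd.

Lemma ideal_exp_ideal (A : comNzRingType) (I : A -> Prop) n : is_ideal (ideal_exp I n).
Proof. by case: n => [|n]; [split | apply: ideal_gen_ideal]. Qed.

Lemma ideal_mulP (A : comNzRingType) (I J : A -> Prop) u v :
  I u -> J v -> ideal_mul I J (u * v).
Proof. by move=> hu hv; apply: mem_ideal_gen; exists u, v. Qed.

Lemma ideal_exp_mono (A : comNzRingType) (I : A -> Prop) n m :
  (n <= m)%N -> sub_ideal (ideal_exp I m) (ideal_exp I n).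
Proof.
move=> /subnK <-; elim: (m - n)%N => [//|e IH] u hu; apply: IH.
move: hu => /(_ _ (ideal_exp_ideal I (e + n))); apply=> _ [v [w [_ hw ->]]].
exact: idealM (ideal_exp_ideal I (e + n)) hw.
Qed.

(** This is the n-th power of R_+, see [exp_highP], because R is generated in degree 1. *)
Definition high n (p : R) := {in msupp (valr p), forall m, (d * n <= mdeg m)%N}.

Lemma valrD (p q : R) : valr (p + q) = valr p + valr q.
Proof. by []. Qed.

Lemma highM i j p q : high i p -> high j q -> high (i + j) (p * q).
Proof.
move=> hp hq m; rewrite rmorphM => /msuppM_le /allpairsP[[m1 m2] /= [h1 h2 ->]].
by rewrite mdegD mulnDr leq_add ?hp ?hq.
Qed.

Lemma high0 (p : R) : high 0 p.
Proof. by move=> m _; rewrite muln0. Qed.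

Lemma high_ideal n : is_ideal (high n).
Proof.
split.
- by move=> m; rewrite rmorph0 mcoeff_msupp mcoeff0 eqxx.
- by move=> p q hp hq m; rewrite valrD => /msuppD_le; rewrite mem_cat => /orP[/hp|/hq].
- by move=> p q hq; apply: (highM (i := 0)) => //; apply: high0.
Qed.

Lemma high_plus (p : R) : monR_plus p -> high 1 p.
Proof.
move=> [n [c [hc ->]]]; apply: (ideal_sum _ (high_ideal 1)) => i _ m hm.
have /dhomogP /(_ m hm) -> := hc i.
by rewrite leq_mul2l orbT.
Qed.

Lemma plus_homog n (p : R) : monR_gr n.+1 p -> monR_plus p.
Proof.
move=> hp; exists n.+1, (fun i => if i == n then p else 0); split.
  move=> i; case: eqP => [->//|_]; rewrite /monR_gr; exact: dhomog0.
rewrite (bigD1 ord_max) //= eqxx big1 ?addr0 // => i.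
by rewrite -val_eqE /= => /negPf ->.
Qed.

Lemma exp_Rmon c i j : inH (apm c i j) /\
  ideal_exp (@monR_plus k a b d) (ht c + i + j) (Rmon (apm c i j)).
Proof.
apply: (apm_ind lt_ab le_bd
  (P := fun n m => inH m /\ ideal_exp (@monR_plus k a b d) n (Rmon m))).
  split=> //; have <- : mn 0 (d * 0) = 0%MM by apply: eq_mnm2; rewrite ?mnE0 ?mnE1 mnm0E ?muln0.
  exact: mn0H.
move=> n x m hx [hm Bm]; have hmx := inH_gen lt_ab le_bd hx.
split; first exact: inH_add.
rewrite (RmonM k hmx hm); apply: ideal_mulP => //; apply: (@plus_homog 0).
rewrite /monR_gr (Rmon_val k hmx) muln1 dhomogX /= mdeg_mn subnKC //.
move: hx; rewrite !inE mem_index_iota => /or3P[/eqP -> //|/eqP -> //|/andP[_]].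
by rewrite ltnS => h; apply: leq_trans h le_bd.
Qed.

Lemma exp_highP n (p : R) : ideal_exp (@monR_plus k a b d) n p <-> high n p.
Proof.
split.
  elim: n p => [|n IH] p; first by move=> _; apply: high0.
  move=> /(_ _ (high_ideal n.+1)); apply=> _ [u [v [hu hv ->]]].
  by rewrite -add1n; apply: highM; [apply: high_plus|apply: IH].
move=> hp; rewrite (monR_expand lt_ab le_bd p) big_seq.
apply: (ideal_sum _ (ideal_exp_ideal _ _)) => m hm.
have := hp m hm; have [c [i [j ->]]] := valr_supp lt_ab le_bd hm.
rewrite mdeg_apm leq_pmul2l // => hn; rewrite -mulr_algl.
apply: (idealM _ (ideal_exp_ideal _ _)); apply: (ideal_exp_mono hn).
by case: (exp_Rmon c i j).
Qed.

Lemma monQ_xd : @monQ k a b d xd.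
Proof.
apply: mem_ideal_gen; left; have := valr_xd k lt_ab le_bd 1; rewrite expr1 muln1.
by move=> h; rewrite [LHS]h -mon_mn expr0 mulr1.
Qed.

Lemma monQ_yd : @monQ k a b d yd.
Proof.
apply: mem_ideal_gen; right; have := valr_yd k lt_ab le_bd 1; rewrite expr1 muln1.
by move=> h; rewrite [LHS]h -mon_mn expr0 mul1r.
Qed.

Definition inQ (p : R) := {in msupp (valr p), forall m,
  exists (c : 'I_d) i j, m = apm c i j /\ (0 < i + j)%N}.

(** The product of two basis monomials lies over a class [c''] with [ht c'' <= ht c + ht c'], so
    comparing degrees shows that factors x^d and y^d are never absorbed. *)
Lemma inQ_ideal : is_ideal inQ.
Proof.
split.
- by move=> m; rewrite rmorph0 mcoeff_msupp mcoeff0 eqxx.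
- by move=> p q hp hq m; rewrite valrD => /msuppD_le; rewrite mem_cat => /orP[/hp|/hq].
- move=> p q hq m; rewrite rmorphM => /msuppM_le /allpairsP[[m1 m2] /= [h1 h2 ->]].
  have [c [i [j e1]]] := valr_supp lt_ab le_bd h1.
  have [c' [i' [j' [e2 pos]]]] := hq _ h2.
  have [c'' [i'' [j'' e]]] : inH (m1 + m2)%MM.
    by apply: inH_add; [exists c, i, j | exists c', i', j'].
  exists c'', i'', j''; split=> //.
  have ed := congr1 mdeg e; have e0 := congr1 (fun m : 'X_{1..2} => m ord0) e.
  move: ed; rewrite e1 e2 mdegD !mdeg_apm -mulnDr => /eqP; rewrite eqn_pmul2l // => /eqP ed.
  move: e0; rewrite /= e1 e2 mnmDE !mnE0 => e0.
  have le_h : (ht c'' <= ht c + ht c')%N.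
    have em : ap c + ap c' = c'' %[mod d].
      rewrite -(apery_mod lt_ab le_bd c'') -(modnMDl i'' (ap c'')) [(i'' * d + _)%N]addnC -e0.
      by rewrite addnACA -mulnDl [in RHS]addnC modnMDl.
    rewrite -(eq_aht lt_ab le_bd em); apply: aht_apery.
      by rewrite mulnDl leq_add ?apery_le.
    apply: (in_sgW lt_ab le_bd (l := ht c + ht c')); rewrite mulnDl leq_add ?apery_le ?apery_ge //.
  lia.
Qed.

Lemma monQ_inQ (p : R) : monQ p -> inQ p.
Proof.
move=> /(_ _ inQ_ideal); apply=> q hq m.
have h0 : (0 < d)%N := d_gt0.
have -> : valr q = if (subalg_val q == xvar k ^+ d) then 'X_[apm 0 1 0] else 'X_[apm 0 0 1].
  have -> : apm 0 1 0 = mn d 0 by rewrite /apm apery0 aht0; congr mn; lia.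
  have -> : apm 0 0 1 = mn 0 d by rewrite /apm apery0 aht0; congr mn; lia.
  rewrite -!mon_mn expr0 mulr1 mul1r.
  by case: hq => h; rewrite [LHS]h; case: eqP => // h'; rewrite -h' h.
case: ifP => _; rewrite msuppX inE => /eqP ->.
  by exists (Ordinal h0), 1%N, 0%N.
by exists (Ordinal h0), 0%N, 1%N.
Qed.

Lemma monR_reduction_number r (c0 : 'I_d) : (forall c : 'I_d, ht c <= r)%N -> ht c0 = r ->
  monR_redn k a b d r.
Proof.
move=> hr h0; split=> [p|n hn]; first split.
- move=> h; apply/exp_highP; move: h => /(_ _ (high_ideal r.+1)); apply=> _ [u [v [hu hv ->]]].
  rewrite -add1n; apply: highM; last exact/exp_highP.
  by move=> m /(monQ_inQ hu) [c [i [j [-> pos]]]]; rewrite mdeg_apm leq_pmul2l //; lia.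
- move=> /exp_highP hp; rewrite (monR_expand lt_ab le_bd p) big_seq.
  apply: (ideal_sum _ (ideal_gen_ideal _)) => m hm.
  have := hp m hm; have [c [i [j ->]]] := valr_supp lt_ab le_bd hm.
  rewrite mdeg_apm leq_pmul2l // => hn; rewrite -mulr_algl.
  apply: (idealM _ (ideal_gen_ideal _)); move: hn; have := hr c.
  rewrite Rmon_apm; case: i => [|i]; [case: j => [|j]|] => h1 h2; first by lia.
    rewrite expr0 mul1r exprS -mulrA; apply: ideal_mulP; first exact: monQ_yd.
    rewrite -[yd ^+ j]mul1r -(expr0 xd) -Rmon_apm.
    by apply: (ideal_exp_mono (m := ht c + 0 + j)); [lia | case: (exp_Rmon c 0 j)].
  rewrite exprS -!mulrA; apply: ideal_mulP; first exact: monQ_xd.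
  rewrite mulrA -Rmon_apm.
  by apply: (ideal_exp_mono (m := ht c + i + j)); [lia | case: (exp_Rmon c i j)].
(* For [n < r] the element [bas c0], of degree [r], lies in the power n + 1 of R_+ but not in Q. *)
- rewrite leqNgt; apply/negP => ltnr.
  have hb : ideal_exp (@monR_plus k a b d) n.+1 (bas c0).
    apply: (ideal_exp_mono (m := ht c0 + 0 + 0)); first by rewrite !addn0 h0.
    by case: (exp_Rmon c0 0 0).
  have : inQ (bas c0).
    move/hn: hb => /(_ _ inQ_ideal); apply=> _ [u [v [hu _ ->]]].
    by rewrite mulrC; apply: (idealM _ inQ_ideal); apply: monQ_inQ.
  move=> /(_ (apm c0 0 0)); rewrite Rmon_valr ?msuppX ?mem_head; last by exists c0, 0%N, 0%N.
  by case=> // c [i [j [/apm_inj[_ <- <-]]]].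
Qed.

End ReductionNumber.

(** * The regularity *)

Section KoszulInstance.
Variables (k : fieldType) (a b d : nat).
Hypotheses (lt_ab : (a < b)%N) (le_bd : (b <= d)%N).
Local Notation R := (monR k a b d).
Local Notation P2 := {mpoly k[2]}.
Local Notation ht := (aht lt_ab le_bd).
Local Notation apm := (apm lt_ab le_bd).
Local Notation inH := (inH lt_ab le_bd).
Local Notation Rmon := (Rmon k a b d).
Local Notation valr := (valr k a b d).
Local Notation bas := (bas k lt_ab le_bd).
Variables (N : nat) (ix iy : 'I_N) (gm : 'I_N -> 'X_{1..2}).
Hypotheses (neq_xy : ix != iy) (gm_ix : gm ix = mn d 0) (gm_iy : gm iy = mn 0 d).
Hypothesis gmH : forall i, inH (gm i).
Hypothesis gm_deg : forall i, mdeg (gm i) = d.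
Local Notation S := {mpoly k[N]}.
Local Notation t := (fun i : 'I_N => Rmon (gm i)).
Local Notation Omega := {mpoly P2[N]}.

Variables (n1 : 'I_N -> 'I_d -> 'I_d) (n2 n3 : 'I_N -> 'I_d -> nat).
Hypothesis nP : forall i (c : 'I_d), (gm i + apm c 0 0)%MM = apm (n1 i c) (n2 i c) (n3 i c).

(* Multiplication by the i-th generator on the basis [bas] of R over k[x^d, y^d]. *)
Definition Zmx i : 'M[S]_d := \matrix_(c, c')
  if c' == n1 i c then 'X_ix ^+ n2 i c * 'X_iy ^+ n3 i c else 0.
Definition psi i : 'M[S]_d := ('X_i)%:M - Zmx i.

(* Evaluating the variables of index in s, besides those of x^d and y^d, at the
   generators of R identifies the quotient of S^d by the images of the [psi i], i in s,
   with a submodule of a domain, on which another [psi i] acts as 'X_i - c. *)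
Definition sub_gen (s : seq 'I_N) (i : 'I_N) : Omega :=
  if [|| i == ix, i == iy | i \in s] then ('X_[gm i])%:MP else 'X_i.
Definition theta (s : seq 'I_N) : {rmorphism S -> Omega} :=
  mmap (@mpolyC N P2 \o @mpolyC 2 k) (sub_gen s).
Definition augs (s : seq 'I_N) (w : 'rV[S]_d) : Omega :=
  \sum_c theta s (w 0 c) * ('X_[apm c 0 0])%:MP.

Lemma thetaX s i : theta s 'X_i = sub_gen s i.
Proof. by rewrite /= mmapX mmap1U. Qed.

Lemma gm_apm c i j :
  (gm ix *+ i + gm iy *+ j + apm c 0 0)%MM = apm c i j.
Proof.
rewrite gm_ix gm_iy !mnMn /apm !mnD; congr mn; first by lia.
by have := apm_le lt_ab le_bd c 0; rewrite !mulnDr; lia.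
Qed.

Lemma theta_Z s i (c : 'I_d) : \sum_c' theta s (Zmx i c c') * ('X_[apm c' 0 0])%:MP =
  ('X_[gm i])%:MP * ('X_[apm c 0 0])%:MP.
Proof.
rewrite (bigD1 (n1 i c)) //= [X in _ + X]big1 ?addr0 => [|c' /negPf nc]; last first.
  by rewrite mxE nc rmorph0 mul0r.
rewrite mxE eqxx rmorphM !rmorphXn /= !thetaX /sub_gen !eqxx orbT /=.
by rewrite -!rmorphXn -!rmorphM /= !mpolyXn -!mpolyXD gm_apm nP.
Qed.

Lemma augs_mul s (M : 'M[S]_d) (x : Omega) (w : 'rV[S]_d) :
  (forall c : 'I_d, \sum_c' theta s (M c c') * ('X_[apm c' 0 0])%:MP = x * ('X_[apm c 0 0])%:MP) ->
  augs s (w *m M) = x * augs s w.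
Proof.
move=> h; rewrite /augs mulr_sumr.
under eq_bigr do rewrite mxE rmorph_sum mulr_suml /=.
rewrite exchange_big; apply: eq_bigr => c _ /=.
under eq_bigr do rewrite rmorphM -mulrA.
by rewrite -mulr_sumr h mulrCA.
Qed.

Lemma augs_Z s i w : augs s (w *m Zmx i) = ('X_[gm i])%:MP * augs s w.
Proof. by apply: augs_mul => c; apply: theta_Z. Qed.

Lemma augsB s u w : augs s (u - w) = augs s u - augs s w.
Proof.
rewrite /augs -sumrB; apply: eq_bigr => c _.
by rewrite !mxE rmorphB mulrBl.
Qed.

Lemma augs_psi s i w : augs s (w *m psi i) = (sub_gen s i - ('X_[gm i])%:MP) * augs s w.
Proof.
rewrite mulmxBr augsB augs_Z mulrBl; congr (_ - _).
rewrite /augs mulr_sumr; apply: eq_bigr => c _.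
by rewrite mul_mx_scalar mxE rmorphM /= -/(theta s _) thetaX mulrA.
Qed.

Lemma augs_im s' s w : {subset s' <= s} -> kos_im (map psi s') w -> augs s w = 0.
Proof.
elim: s' w => [|i s' IH] /= w hs.
  by move=> ->; rewrite /augs big1 // => c _; rewrite mxE rmorph0 mul0r.
have hs' : {subset s' <= s} by move=> j hj; apply: hs; rewrite inE hj orbT.
move=> [w' /(IH _ hs')].
rewrite augsB augs_psi /sub_gen hs ?mem_head // !orbT subrr mul0r subr0; exact.
Qed.

(** The entries of normal forms modulo the images of the [psi i], i in [s]; [decomp] reduces every
    vector to such a form. *)
Definition tfree (s : seq 'I_N) (p : S) :=
  {in msupp p, forall m : 'X_{1..N}, {in s, forall i, m i = 0%N}}.

Lemma tfree0 s : tfree s 0.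
Proof. by move=> m; rewrite mcoeff_msupp mcoeff0 eqxx. Qed.

Lemma tfreeD s p q : tfree s p -> tfree s q -> tfree s (p + q).
Proof. by move=> hp hq m /msuppD_le; rewrite mem_cat => /orP[/hp|/hq]. Qed.

Lemma tfreeN s p : tfree s p -> tfree s (- p).
Proof. by move=> hp m; rewrite (perm_mem (msuppN p)); apply: hp. Qed.

Lemma tfreeM s p q : tfree s p -> tfree s q -> tfree s (p * q).
Proof.
move=> hp hq m /msuppM_le /allpairsP[[m1 m2] /= [h1 h2 ->]] i hi.
by rewrite mnmDE (hp _ h1) ?(hq _ h2).
Qed.

Lemma tfreeX s i : i \notin s -> tfree s 'X_i.
Proof.
move=> hi m; rewrite msuppX inE => /eqP -> j hj.
by rewrite mnm1E; case: eqP => // e; rewrite e hj in hi.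
Qed.

Lemma tfreeXn s i n : i \notin s -> tfree s ('X_i ^+ n).
Proof.
move=> hi; elim: n => [|n IH]; last by rewrite exprS; apply: tfreeM => //; apply: tfreeX.
by move=> m; rewrite expr0 msupp1 inE => /eqP -> j _; rewrite mnm0E.
Qed.

Definition big_idx (s : seq 'I_N) := ix \notin s /\ iy \notin s.

Lemma tfree_Z s i c c' : big_idx s -> tfree s (Zmx i c c').
Proof.
move=> hs; rewrite mxE; case: ifP => _; last exact: tfree0.
by case: hs => hx hy; apply: tfreeM; apply: tfreeXn.
Qed.

Lemma tfree_mulZ s i (w : 'rV[S]_d) : big_idx s ->
  (forall c, tfree s (w 0 c)) -> forall c, tfree s ((w *m Zmx i) 0 c).
Proof.
move=> hs hw c; rewrite mxE; apply: big_ind => [|p q|c' _].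
- exact: tfree0.
- exact: tfreeD.
- by apply: tfreeM => //; apply: tfree_Z.
Qed.

Definition zeta (m : 'X_{1..N}) : 'X_{1..N} :=
  [multinom if (i == ix) || (i == iy) then 0%N else m i | i < N].

Lemma theta_monomial s (m : 'X_{1..N}) (c : 'I_d) : big_idx s ->
  {in s, forall i, m i = 0%N} ->
  mmap1 (sub_gen s) m * ('X_[apm c 0 0])%:MP =
  ('X_[apm c (m ix) (m iy)])%:MP * 'X_[zeta m] :> Omega.
Proof.
move=> hs hm; rewrite /mmap1 (bigD1 iy) // (bigD1 ix) //.
rewrite {1 2}/sub_gen !eqxx orbT /= [\prod_(_ | _) _](_ : _ = 'X_[zeta m]); last first.
  symmetry; rewrite mpolyXE_id (bigD1 iy) // (bigD1 ix) // !mnmE !eqxx orbT orTb !expr0 /= !mul1r.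
  apply: eq_bigr => i /andP[/negPf niy /negPf nix].
  rewrite mnmE niy nix /= /sub_gen niy nix /=; case: ifP => // /hm ->.
  by rewrite !expr0.
rewrite -(gm_apm c (m ix) (m iy)) 2!mpolyXD -!mpolyXn 2!rmorphM !rmorphXn /=; ring.
Qed.

(** Distinct pairs of a basis index and a monomial of a normal form go to distinct monomials: the
    index and the exponents of ['X_ix] and ['X_iy] are recovered by [apm_inj], the other exponents
    from [zeta]. *)
Lemma augs_inj s (q : 'rV[S]_d) : big_idx s -> (forall c, tfree s (q 0 c)) ->
  augs s q = 0 -> q = 0.
Proof.
move=> hs hq h; apply/rowP => c0; rewrite mxE; apply/mpolyP => m0; rewrite mcoeff0.
have [hm0|/memN_msupp_eq0 //] := boolP (m0 \in msupp (q 0 c0)).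
have E c : theta s (q 0 c) * ('X_[apm c 0 0])%:MP =
   \sum_(m <- msupp (q 0 c)) (('X_[apm c (m ix) (m iy)])%:MP * 'X_[zeta m]) * ((q 0 c)@_m)%:MP%:MP.
  rewrite /= /mmap mulr_suml; apply: eq_big_seq => m hm.
  rewrite -[LHS]mulrA theta_monomial //; last by apply: hq hm.
  exact: mulrC.
have /(congr1 (fun x : Omega => x@_(zeta m0)@_(apm c0 (m0 ix) (m0 iy)))) := h.
rewrite /augs; under eq_bigr do rewrite E.
rewrite !raddf_sum /= !mcoeff0.
have F (c : 'I_d) m : m \in msupp (q 0 c) ->
   (('X_[apm c (m ix) (m iy)])%:MP * 'X_[zeta m] * ((q 0 c)@_m)%:MP%:MP : Omega)
     @_(zeta m0)@_(apm c0 (m0 ix) (m0 iy)) =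
   if (c == c0) && (m == m0) then (q 0 c)@_m else 0.
  move=> hm; rewrite mulrC mulrA -rmorphM /= mcoeffCM mcoeffX mulr_natr mcoeffMn mcoeffCM mcoeffX.
  case: (m =P m0) => [->|nm]; last first.
    rewrite andbF; case: eqP => [/apm_inj[_ ex ey]|]; last by rewrite mulr0 mul0rn.
    case: eqP => [e1|]; last by rewrite mulr0n.
    case: nm; apply/mnmP => i; have := congr1 (fun m : 'X_{1..N} => m i) e1.
    by rewrite !mnmE; case: (i =P ix) => [->|_] //; case: (i =P iy) => [->|_].
  rewrite eqxx andbT mulr1n; case: (c =P c0) => [->|nc]; first by rewrite eqxx mulr1.
  by case: eqP => [/apm_inj[]|]; rewrite ?mulr0.
rewrite (bigD1 c0) //= [X in _ + X]big1 ?addr0; last first.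
  move=> c /negPf nc; rewrite !raddf_sum big_seq big1 //= => m hm.
  by rewrite F // nc.
rewrite !raddf_sum big_seq /=; under eq_bigr => m hm do rewrite F // eqxx /=.
rewrite -big_seq (bigD1_seq m0) ?msupp_uniq //= eqxx big1 ?addr0 //.
by move=> m /negPf ->.
Qed.

(** Through [augs], both products act as multiplication by the same element of a commutative ring,
    and [augs] is injective on the vectors concerned. *)
Lemma Zmx_comm i j : Zmx i *m Zmx j = Zmx j *m Zmx i.
Proof.
have big0 : big_idx [seq i <- enum 'I_N | (i != ix) && (i != iy)].
  by split; rewrite mem_filter eqxx // andbF.
apply/row_matrixP => c; apply/eqP; rewrite -subr_eq0; apply/eqP.
rewrite !rowE; apply: (augs_inj big0).
  have free_delta c' : tfree [seq i <- enum 'I_N | (i != ix) && (i != iy)]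
      ((delta_mx 0 c : 'rV[S]_d) 0 c').
    rewrite mxE; case: (_ && _); last exact: tfree0.
    by move=> m; rewrite msupp1 inE => /eqP -> l _; rewrite mnm0E.
  move=> c'; rewrite !mulmxA [X in tfree _ X]mxE [X in _ + X]mxE; apply: tfreeD.
    by do 2!apply: (@tfree_mulZ _ _ _ big0).
  by apply: tfreeN; do 2!apply: (@tfree_mulZ _ _ _ big0).
by rewrite augsB !mulmxA !augs_Z mulrCA subrr.
Qed.

Lemma psi_Z_comm i j : psi i *m Zmx j = Zmx j *m psi i.
Proof. by rewrite mulmxBl mulmxBr Zmx_comm scalar_mxC. Qed.

Lemma psi_comm i j : psi i *m psi j = psi j *m psi i.
Proof.
by rewrite [psi j in LHS]/psi mulmxBr scalar_mxC psi_Z_comm -mulmxBl.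
Qed.

(** Modulo the image of [psi i], multiplication by ['X_i] may be replaced by [Zmx i], whose entries
    involve only ['X_ix] and ['X_iy]. *)
Lemma decomp s w : big_idx s ->
  exists q : 'rV[S]_d, (forall c, tfree s (q 0 c)) /\ kos_im (map psi s) (w - q).
Proof.
move=> hs; pose P w := exists q : 'rV[S]_d,
  (forall c, tfree s (q 0 c)) /\ kos_im (map psi s) (w - q).
have PD u v : P u -> P v -> P (u + v).
  move=> [q [hq hu]] [r [hr hv]]; exists (q + r); split=> [c|].
    by rewrite mxE; apply: tfreeD.
  by rewrite opprD addrACA; apply: kos_imD.
have imZ (f : S) u : kos_im (map psi s) u -> kos_im (map psi s) (f *: u).
  rewrite -mul_mx_scalar; apply: kos_imM => Y _; exact: scalar_mxC.
have PZ (p : S) u : tfree s p -> P u -> P (p *: u).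
  move=> hp [q [hq hu]]; exists (p *: q); split=> [c|].
    by rewrite mxE; apply: tfreeM.
  by rewrite -scalerBr; apply: imZ.
have PX i u : P u -> P ('X_i *: u).
  move=> Pu; have [hi|hi] := boolP (i \in s); last exact/PZ/Pu/tfreeX.
  have [q [hq hu]] := Pu; exists (q *m Zmx i); split; first exact: tfree_mulZ.
  have -> : 'X_i *: u - q *m Zmx i = u *m psi i + (u - q) *m Zmx i.
    by rewrite mulmxBr mulmxBl mul_mx_scalar addrA subrK.
  apply: kos_imD; first by apply: kos_im_mem; apply: map_f.
  by apply: kos_imM hu => Y /mapP[j _ ->]; apply: psi_Z_comm.
have Pp (p : S) u : P u -> P (p *: u).
  move=> Pu; elim/mpolyind: p => [|c m p _ _ IH].
    rewrite scale0r; exists 0; split=> [c|]; first by rewrite mxE; apply: tfree0.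
    by rewrite subr0; apply: kos_im0.
  rewrite scalerDl; apply: PD; last exact: IH.
  rewrite -mul_mpolyC -scalerA; apply: PZ.
    by move=> m'; rewrite msuppC; case: ifP => // _; rewrite inE => /eqP -> j _; rewrite mnm0E.
  rewrite mpolyXE_id; elim/big_rec: _ => [|i x _ Px]; first by rewrite scale1r.
  rewrite -scalerA; elim: (m i) => [|e IHe]; first by rewrite expr0 scale1r.
  by rewrite exprS -scalerA; apply: PX.
rewrite -/(P w) [w]matrix_sum_delta big_ord1; apply: big_ind => // [|c _].
  exists 0; split=> [c|]; first by rewrite mxE; apply: tfree0.
  by rewrite subr0; apply: kos_im0.
apply: Pp; exists (delta_mx 0 c); split=> [c'|]; last by rewrite subrr; apply: kos_im0.
rewrite mxE; case: (_ && _); last exact: tfree0.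
by move=> m; rewrite msupp1 inE => /eqP -> l _; rewrite mnm0E.
Qed.

Lemma ker_augs s w : big_idx s -> augs s w = 0 -> kos_im (map psi s) w.
Proof.
move=> hs hw; have [q [hq him]] := decomp w hs.
suff q0 : q = 0 by move: him; rewrite q0 subr0.
apply: (augs_inj hs hq); apply/eqP; rewrite -oppr_eq0; apply/eqP.
by rewrite -[LHS]add0r -{1}hw -augsB; apply: augs_im him.
Qed.

Lemma psi_regular s : big_idx s -> uniq s -> kos_regular (map psi s).
Proof.
elim: s => [//|i s IH] [hx hy] /= /andP[nis us].
have hs : big_idx s by split; [move: hx|move: hy]; rewrite inE negb_or => /andP[].
split=> [|w hw]; first exact: IH.
apply: ker_augs => //.
have : augs s (w *m psi i) = 0 by apply: augs_im hw.
rewrite augs_psi /sub_gen (negPf nis) => /mpoly_idomainAxiom/orP[|/eqP //].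
move: hx hy; rewrite !inE !negb_or ![_ == i]eq_sym => /andP[/negPf -> _] /andP[/negPf -> _] /=.
move=> /eqP /(congr1 (fun p : Omega => p@_U_(i))).
rewrite mcoeffB mcoeffX eqxx mcoeffC mnm1_eq0 mulr0 subr0 mcoeff0 => /eqP.
by rewrite oner_eq0.
Qed.

Lemma augs_full s w : (forall i, [|| i == ix, i == iy | i \in s]) ->
  augs s w = (valr (\sum_c gen_eval t (w 0 c) * bas c))%:MP.
Proof.
move=> hs; rewrite rmorph_sum rmorph_sum; apply: eq_bigr => c _.
rewrite [valr _]rmorphM rmorphM [valr (bas c)]Rmon_valr; last by exists c, 0%N, 0%N.
congr (_ * _); rewrite -[LHS]/(mmap _ _ _) /gen_eval /mmap.
rewrite [valr _]rmorph_sum rmorph_sum; apply: eq_bigr => m _.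
rewrite [valr _]rmorphM rmorphM; congr (_ * _).
  by rewrite [in_alg _ _]/(_ *: _) valrZ rmorph1 -mul_mpolyC mulr1.
rewrite /mmap1 [valr _]rmorph_prod rmorph_prod; apply: eq_bigr => i _.
by rewrite [valr _]rmorphXn rmorphXn /sub_gen hs Rmon_valr.
Qed.

Lemma psi_deg i (c c' : 'I_d) : gdeg (psi i c c') (ht c).+1 (ht c').
Proof.
rewrite !mxE; apply: gdegD; last apply: gdegN; first case: eqP => [->|_].
- by move=> m; rewrite mulr1n msuppX inE => /eqP ->; rewrite mdeg1.
- by rewrite mulr0n; apply: gdeg0.
case: eqP => [->|_]; last exact: gdeg0.
rewrite !mpolyXn -mpolyXD => m; rewrite msuppX inE => /eqP ->.
rewrite mdegD !mdegMn !mdeg1 !mul1n.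
have := congr1 mdeg (nP i c); rewrite mdegD !mdeg_apm !addn0 gm_deg -mulnS.
move=> /eqP; rewrite (eqn_pmul2l (leq_ltn_trans (leq0n c) (ltn_ord c))) => /eqP.
clear; lia.
Qed.

Lemma gen_evalM (p q : S) : gen_eval t (p * q) = gen_eval t p * gen_eval t q.
Proof. exact: (rmorphM (eval_rmorph t)). Qed.

Lemma gen_evalD (p q : S) : gen_eval t (p + q) = gen_eval t p + gen_eval t q.
Proof. exact: (rmorphD (eval_rmorph t)). Qed.

Lemma gen_evalb (c : bool) : gen_eval t (c%:R : S) = c%:R.
Proof. by case: c; [exact: (rmorph1 (eval_rmorph t)) | exact: (rmorph0 (eval_rmorph t))]. Qed.

Lemma monR_regularity_of_generators r (c0 : 'I_d) :
  (forall c : 'I_d, ht c <= r)%N -> ht c0 = r ->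
  regularity (@monR_gr k a b d) t r%:Z.
Proof.
move=> hr h0.
pose s := [seq i <- enum 'I_N | (i != ix) && (i != iy)].
have hs : big_idx s by split; rewrite mem_filter eqxx // andbF.
have full i : [|| i == ix, i == iy | i \in s].
  by rewrite mem_filter mem_enum inE; case: (i == ix) (i == iy) => [] [].
apply: (@koszul_regularity _ _ _ _ _ _ (fun c : 'I_d => ht c) (fun c : 'I_d => bas c)
   (map psi s) r c0) => //.
- by move=> Y Z /mapP[i _ ->] /mapP[j _ ->]; apply: psi_comm.
- by apply: psi_regular => //; rewrite filter_uniq ?enum_uniq.
- by move=> Y /mapP[i _ ->] c c'; apply: psi_deg.
- move=> w; split=> [h|h].
    have := augs_im (fun i (hi : i \in s) => hi) h.
    rewrite (augs_full _ full) => /eqP; rewrite mpolyC_eq0 => /eqP e.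
    by apply: valr_inj; rewrite e rmorph0.
  by apply: ker_augs => //; rewrite (augs_full _ full) h !rmorph0.
- have eX i : gen_eval t 'X_i = t i by rewrite /gen_eval mmapX mmap1U.
  have mulX i (w : 'rV[S]_d) : Rmon (gm i) * (\sum_c gen_eval t (w 0 c) * bas c) =
      \sum_c gen_eval t (('X_i *: w) 0 c) * bas c.
    rewrite mulr_sumr; apply: eq_bigr => c _.
    by rewrite mxE gen_evalM eX mulrA.
  elim/(@monR_ind k a b d lt_ab le_bd) => [x y [u ->] [v ->]|c x [u ->]|x [u ->]|x [u ->]|c].
  + exists (u + v); rewrite -big_split; apply: eq_bigr => c _.
    by rewrite mxE gen_evalD mulrDl.
  + exists (c%:MP *: u); rewrite scaler_sumr; apply: eq_bigr => c' _.
    by rewrite mxE gen_evalM [gen_eval t c%:MP]mmapC /= mulr_algl scalerAl.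
  + by exists ('X_iy *: u); rewrite -mulX gm_iy.
  + by exists ('X_ix *: u); rewrite -mulX gm_ix.
  + exists (delta_mx 0 c); rewrite (bigD1 c) //= mxE !eqxx gen_evalb mul1r.
    by rewrite big1 ?addr0 // => c' /negPf nc; rewrite mxE nc andbF gen_evalb mul0r.
- move=> c; rewrite /monR_gr (Rmon_val k); last by exists c, 0%N, 0%N.
  by rewrite dhomogX /= mdeg_apm !addn0.
Qed.

End KoszulInstance.

Section MonomialAlgebra.
Variables (k : fieldType) (a b d : nat).
Hypotheses (lt_ab : (a < b)%N) (le_bd : (b <= d)%N).
Local Notation ht := (aht lt_ab le_bd).
Local Notation apm := (apm lt_ab le_bd).
Local Notation inH := (inH lt_ab le_bd).
Local Notation Rmon := (Rmon k a b d).

Lemma monR_regularity r (c0 : 'I_d) : (forall c : 'I_d, ht c <= r)%N -> ht c0 = r ->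
  monR_reg k a b d r%:Z.
Proof.
move=> hr h0.
(* The number of generators becomes a variable [N], so that [eqN] can be eliminated by substitution
   at the end instead of leaving casts in the statement. *)
have [N [gm [ix [iy [eqN [genE nxy gx gy [gH gdeg]]]]]]] : exists N (gm : 'I_N -> 'X_{1..2})
    (ix iy : 'I_N) (eqN : N = size (monomials k a b d)),
    [/\ forall i, subalg_gen (cast_ord eqN i) = Rmon (gm i),
     ix != iy, gm ix = mn d 0, gm iy = mn 0 d
     & (forall i, inH (gm i)) /\ forall i, mdeg (gm i) = d].
  pose x0 := 0%N :: d :: index_iota a b.+1; pose x i := nth 0%N x0 i.
  have hx (i : 'I_(size x0)) : x i \in x0 by apply: mem_nth.
  have eqN : size x0 = size (monomials k a b d) by rewrite size_map.
  exists (size x0), (fun i => mn (x i) (d - x i)).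
  exists (@Ordinal (size x0) 1 isT), (@Ordinal (size x0) 0 isT), eqN.
  split=> //=; [|by rewrite /x /= subnn|by rewrite /x /= subn0|split] => i.
  - apply: valr_inj; rewrite (Rmon_valr k (inH_gen lt_ab le_bd (hx i))) -mon_mn.
    by rewrite -[LHS]/(nth 0 (monomials k a b d) i) (nth_map 0%N).
  - exact: inH_gen.
  - rewrite mdeg_mn subnKC //; move: (hx i); rewrite !inE mem_index_iota.
    case/or3P=> [/eqP -> //|/eqP -> //|/andP[_]].
    by rewrite ltnS => h; apply: leq_trans h le_bd.
have nxP (ic : 'I_N * 'I_d) : exists x : 'I_d * nat * nat,
    (gm ic.1 + apm ic.2 0 0)%MM = apm x.1.1 x.1.2 x.2.
  have [c [i [j e]]] : inH (gm ic.1 + apm ic.2 0 0)%MM.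
    by apply: inH_add; [exact: gH | exists ic.2, 0%N, 0%N].
  by exists (c, i, j).
have [nx hnx] := choice nxP.
have := @monR_regularity_of_generators k a b d lt_ab le_bd N ix iy gm nxy gx gy gH gdeg
  (fun i c => (nx (i, c)).1.1) (fun i c => (nx (i, c)).1.2) (fun i c => (nx (i, c)).2)
  (fun i c => hnx (i, c)) r c0 hr h0.
rewrite (_ : (fun i => _) = fun i => subalg_gen (cast_ord eqN i)); last first.
  by apply/funext => i; rewrite genE.
move: eqN {genE nxy gx gy gH gdeg nxP hnx nx ix iy gm} => eqN; subst N.
rewrite (_ : (fun i => _) = @subalg_gen k _ (monomials k a b d)) //.
by apply/funext => i; rewrite cast_ord_id.
Qed.

End MonomialAlgebra.

(** * The maximal degree of a basis element *)

Section Ceiling.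
Variables (b n : nat).

Lemma ceil_cdiv : (0 < b)%N -> (0 < n)%N ->
  (cdiv b n)%:Z = Num.ceil (n%:R / b%:R : rat).
Proof.
move=> b0 n0; apply/esym/ceil_def.
have hb : 0 < b%:R :> rat by rewrite ltr0n.
rewrite ltr_pdivlMr // ler_pdivrMr // -[(cdiv b n)%:~R]/((cdiv b n)%:R) -natrM ler_nat.
have h0 l : (cdiv b n <= l)%N = (n <= l * b)%N by rewrite /cdiv -ltnS ltn_divLR // mulSn; lia.
rewrite -h0 leqnn andbT.
have c0 : (0 < cdiv b n)%N by rewrite ltnNge h0 mul0n -ltnNge.
case E : (cdiv b n) c0 => [//|m] _; rewrite -addn1 PoszD addrK.
by rewrite -[_%:~R]/(m%:R) -natrM ltr_nat ltnNge -h0 E ltnn.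
Qed.

End Ceiling.

Section MaximalHeight.
Variables (a b d : nat).
Hypotheses (ha : (2 <= a)%N) (lt_ab : (a < b)%N) (hbd : (b <= d - 2)%N).
Local Open Scope nat_scope.

Lemma le_bd_of_hbd : b <= d. Proof. lia. Qed.

Local Notation le_bd := le_bd_of_hbd.
Local Notation ap := (apery lt_ab le_bd).
Local Notation ht := (aht lt_ab le_bd).

Lemma in_sg_lt x : 0 < x -> x < a -> ~~ in_sg a b x.
Proof.
move=> x0 xa; rewrite /in_sg -ltnNge; apply: (leq_trans xa).
have : 0 < cdiv b x by rewrite ltnNge (cdiv_le lt_ab le_bd) mul0n -ltnNge.
by move=> h; rewrite -{1}[a]mul1n leq_mul2r h orbT.
Qed.

Lemma in_sg_gap x : b < x -> x < 2 * a -> ~~ in_sg a b x.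
Proof.
move=> bx xa; rewrite /in_sg -ltnNge; apply: (leq_trans xa).
have : 1 < cdiv b x by rewrite ltnNge (cdiv_le lt_ab le_bd) mul1n -ltnNge.
by move=> h; rewrite leq_mul2r h orbT.
Qed.

(* [l] summands from [a, b] cover [l a, l b]; these intervals overlap from [q a] on. *)
Lemma in_sg_ge q x : 0 < q -> (forall l, q <= l -> l.+1 * a <= (l * b).+1) -> q * a <= x ->
  in_sg a b x.
Proof.
move=> q0 hq hx; have a0 : 0 < a by lia.
apply: (in_sgW lt_ab le_bd (l := x %/ a)); first exact: leq_trunc_div.
have hl : q <= x %/ a by rewrite leq_divRL.
have := hq _ hl; have := ltn_ceil x a0; lia.
Qed.

Lemma apery_eq c x : in_sg a b x -> x = c %[mod d] ->
  (forall y, y < x -> y = c %[mod d] -> ~~ in_sg a b y) -> ap c = x.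
Proof.
move=> hx hc hmin; apply/eqP; rewrite eqn_leq apery_min //= leqNgt; apply/negP => h.
by have := hmin _ h (apery_mod lt_ab le_bd c); rewrite apery_sg.
Qed.

Lemma ht_le c x : ap c <= x -> ht c <= cdiv b x.
Proof. by move=> h; rewrite /aht leq_div2r // leq_add2r. Qed.

Lemma congr_lt x y : y < x -> y = x %[mod d] -> exists f, x = y + f * d + d.
Proof.
move=> yx /eqP; rewrite eq_sym eqn_mod_dvd 1?ltnW // => /dvdnP[[|f] e]; first by lia.
by exists f; lia.
Qed.

(** Here the intervals [l a, l b] overlap from l = 1 on, so the largest gap of the semigroup is a -
    1, and its class has the largest least element, a - 1 + d. *)
Lemma max_ht1 : 2 * a <= b.+1 -> exists c0 : 'I_d,
  ht c0 = cdiv b (a + d - 1) /\ forall c : 'I_d, ht c <= cdiv b (a + d - 1).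
Proof.
move=> hb; have sg x : a <= x -> in_sg a b x.
  by rewrite -[X in X <= _]mul1n; apply: in_sg_ge => // l; nia.
have lt0 : a - 1 < d by lia.
have em : a + d - 1 = a - 1 %[mod d].
  have -> : a + d - 1 = a - 1 + d by lia.
  by rewrite modnDr.
exists (Ordinal lt0); split=> [|c].
  rewrite /aht (@apery_eq _ (a + d - 1)) //; first by apply: sg; lia.
  move=> y hy /= hm; have [f hf] := congr_lt hy (etrans hm (esym em)).
  by apply: in_sg_lt; case: f hf => [|f]; rewrite ?mulSn; lia.
apply: ht_le; have hc := ltn_ord c.
have [ac|ca] := leqP a c.
  by apply: (@leq_trans c); [apply: apery_min => //; apply: sg | lia].
apply: (@leq_trans (c + d)); last by lia.
by apply: apery_min; [apply: sg; lia | rewrite modnDr].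
Qed.

(** The overlaps start at l = 2, so the largest gap is 2a - 1, and its class has least element 2a -
    1 + d. If d = 2a - 1, however, this class contains 0, and the class of 2a - 2 takes over. *)
Lemma max_ht2 : 3 * a <= (2 * b).+1 -> b.+1 < 2 * a -> exists c0 : 'I_d,
  ht c0 = cdiv b (2 * a + d - 1) /\ forall c : 'I_d, ht c <= cdiv b (2 * a + d - 1).
Proof.
move=> hb1 hb2; have sg x : 2 * a <= x -> in_sg a b x.
  by apply: in_sg_ge => // l; nia.
have d0 : 0 < d by lia.
have bound (c : 'I_d) : ht c <= cdiv b (2 * a + d - 1).
  apply: ht_le; have hc := ltn_ord c.
  have [ac|ca] := leqP (2 * a) c.
    by apply: (@leq_trans c); [apply: apery_min => //; apply: sg | lia].
  have [ac|ca'] := leqP (2 * a) (c + d).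
    by apply: (@leq_trans (c + d)); [apply: apery_min; [apply: sg | rewrite modnDr] | lia].
  apply: (@leq_trans (c + d + d)); last by lia.
  by apply: apery_min; [apply: sg; lia | rewrite !modnDr].
have [e|/eqP ne] := eqVneq d (2 * a - 1).
  have lt0 : 2 * a - 2 < d by lia.
  exists (Ordinal lt0); split=> //; rewrite /aht (@apery_eq _ (2 * a - 2 + d)) //=.
  (* Both 4a - 3 and 4a - 2 lie above 2b and are at most 3b, so the shift by one does not change the
     ceiling. *)
  - have h3 x : 2 * b < x -> x <= 3 * b -> cdiv b x = 3.
      move=> h2 h3; apply/eqP.
      by rewrite eqn_leq (cdiv_le lt_ab le_bd) h3 ltnNge (cdiv_le lt_ab le_bd) -ltnNge.
    by rewrite !h3 //; lia.
  - by apply: sg; lia.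
  - by rewrite modnDr.
  - move=> y hy hm; have [f hf] := congr_lt hy (etrans hm (esym (modnDr _ _))).
    by apply: in_sg_gap; case: f hf => [|f]; rewrite ?mulSn; lia.
exists (Ordinal (ltn_pmod (2 * a - 1) d0)); split=> //.
rewrite /aht (@apery_eq _ (2 * a + d - 1)) //=.
- by apply: sg; lia.
- have -> : 2 * a + d - 1 = 2 * a - 1 + d by lia.
  by rewrite modn_mod modnDr.
move=> y hy; rewrite modn_mod => hm.
have [||f hf] := @congr_lt (2 * a - 1 + d) y; first by lia.
  by rewrite modnDr.
(* The smaller candidates are 2a - 1, a gap above b, and 2a - 1 - d, which is below a and nonzero by
   [ne]; a further d would make it negative. *)
case: f hf => [|[|f]] hf; [apply: in_sg_gap|apply: in_sg_lt|]; rewrite ?mulSn in hf; lia.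
Qed.

End MaximalHeight.

Theorem theorem3p3 (k : fieldType) (a b d : nat)
    (ha : (2 <= a)%N) (hab : (a < b)%N) (hbd : (b <= d - 2)%N) :
  [/\ cohen_macaulay (monR k a b d),
      2 * a%:R - 1 <= b%:R :> rat ->
        exists r : nat,
          [/\ monR_reg k a b d r%:Z, monR_redn k a b d r
            & r%:Z = Num.ceil ((a%:R + d%:R - 1) / b%:R : rat)]
    & (3 * a%:R - 1) / 2 <= b%:R :> rat -> b%:R < 2 * a%:R - 1 :> rat ->
        exists r : nat,
          [/\ monR_reg k a b d r%:Z, monR_redn k a b d r
            & r%:Z = Num.ceil ((2 * a%:R + d%:R - 1) / b%:R : rat)]].
Proof.
have hle := le_bd_of_hbd ha hab hbd.
have b0 : (0 < b)%N by lia.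
split; first exact: monR_cohen_macaulay hab hle.
- rewrite lerBlDr -natrM natr1 ler_nat => h1.
  have [c0 [h0 hr]] := max_ht1 ha hab hbd h1.
  exists (cdiv b (a + d - 1)); split.
  + exact: monR_regularity hr h0.
  + exact: monR_reduction_number hr h0.
  + by rewrite ceil_cdiv ?natrB ?natrD //; lia.
- rewrite ler_pdivrMr // lerBlDr -!natrM natr1 ler_nat ltrBrDr natr1 ltr_nat.
  rewrite [(b * 2)%N]mulnC => h1 h2.
  have [c0 [h0 hr]] := max_ht2 ha hab hbd h1 h2.
  exists (cdiv b (2 * a + d - 1)); split.
  + exact: monR_regularity hr h0.
  + exact: monR_reduction_number hr h0.
  + by rewrite ceil_cdiv ?natrB ?natrD ?natrM //; lia.
Qed.
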